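(* Let $P$ and $Q$ be balanced straight-line programs (BSLs), both deadlock-free, and let $(V_P,E_P)=\mathrm{Sig}(P)$ and $(V_Q,E_Q)=\mathrm{Sig}(Q)$ be their signatures. Then $Q$ properly seals $P$ in $\mathrm{Rel}$ if and only if for all $i,j\in\mathbb P$ with $\mathsf{rcv}^{j\leftarrow i}\in V_P$ there exists $k\in\mathbb P$ such that (a) $(\mathsf{rcv}^{j\leftarrow i},\mathsf{lst}_k)\in E_P$, (b) $(\mathsf{fst}_k,\mathsf{lst}_i)\in E_Q$, and (c) if $\mathsf{snd}^{i\to j}\in V_Q$ then $(\mathsf{fst}_k,\mathsf{snd}^{i\to j})\in E_Q$.
   Context: Programs. Let $n\in\mathbb N$ and $\mathbb P=\{1,\dots,n\}$ (processes). Process $i$ has a set $Var_i$ of program variables (mutually disjoint) and a reserved communication history $h_i\notin Var_i$; $Expr_i$ is the set of arithmetic expressions over $Var_i$. The program constructs needed here are the empty program $\epsilon$, assignments $x:=\mathsf e$, sends $\mathsf{snd}^{i\to j}_{\mathsf e}$, receives $\mathsf{rcv}^{j\leftarrow i}_x$, the silent cut $\wr$, and layering $P\bullet Q$; assignments and sends of process $i$ use variables and expressions of $i$, and a receive of $j$ stores into a variable of $j$. Subscripts of sends and receives are omitted when irrelevant. Runs. A local state of $i$ maps $Var_i$ to values and $h_i$ to a sequence of send records $(i\to j,v)$ and receive records $(i\leftarrow j,v)$. A local run $r_i$ is an infinite sequence of local states $r_i(0),r_i(1),\dots$; an event of $i$ is a transition between consecutive local states (the transition $r_i(k-1)\to r_i(k)$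 has index $k$), and is a send, receive or internal event. A run $r=((r_i)_{i\in\mathbb P},\delta_r)$ consists of local runs and an injective (total) matching function $\delta_r$ from receive events to send events such that: (1) if $\delta_r(e)=e'$ and $e$ appends $(j\leftarrow i,v)$ to $h_j$, then $e'$ is a send event of $i$ appending $(i\to j,v)$ to $h_i$; (2) Lamport causality $\to_L$, the smallest transitive relation containing the local order of events of each process and all pairs $(\delta_r(e),e)$, is irreflexive. $\mathrm{Rel}$ is the set of runs in which no unmatched send event is succeeded by infinitely many matched send events on the same channel. Cuts. A cut $(r,c)$ is a run with $c\in(\mathbb N\cup\{\infty\})^{\mathbb P}$, ordered componentwise; it is finite if all $c_i$ are. An event of $i$ is in $(r,c)$ if its index is $\le c_i$. Channel $\mathsf{chan}_{i\to j}$ at $(r,c)$ is the set of $i$'s send events to $j$ and $j$'s receive events from $i$ in $(r,c)$ that are not matched by $\delta_r$ to an event also in $(r,c)$; it is empty if this set is. An interval $r[c,d]$ is given by cuts $(r,c),(r,d)$ with $c\le d$. Occurrence $r[c,d]\Vdash P$: $\epsilon$: $c=d$. $x:=\mathsf e$ (of $i$): $d=c[i\mapsto c_i+1]$ and $r_i(d_i)=r_i(c_i)[x\mapsto v]$, $v$ the value of $\mathsf e$ in $r_i(c_i)$. $\mathsf{snd}^{i\to j}_{\mathsf e}$: $d=c[i\mapsto c_i+1]$ and $r_i(d_i)$ is $r_i(c_i)$ with $(i\to j,v)$ appended to $h_i$, $v$ the value of $\mathsf e$ in $r_i(c_i)$. $\mathsf{rcv}^{i\leftarrow j}_x$: $d=c[i\mapsto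 c_i+1]$ and, for some $v$, $r_i(d_i)$ is $r_i(c_i)$ with $(i\leftarrow j,v)$ appended to $h_i$ and $x\mapsto v$. $\wr$: $c=d$ and no communication event in $(r,c)$ is matched by $\delta_r$ with an event outside $(r,c)$. $P\bullet Q$: there is $c'$ with $c\le c'\le d$, $r[c,c']\Vdash P$, $r[c',d]\Vdash Q$. Refinement: $P\leq_\Gamma Q$ (for a set $\Gamma$ of runs) iff for all $r\in\Gamma$ and all $c,d$, $r[c,d]\Vdash P$ implies $r[c,d]\Vdash Q$. Sealing. $S$ seals $P$ in $\Gamma$ if $\wr\bullet P\bullet S\leq_\Gamma P\bullet\wr\bullet S$. $S$ properly seals $P$ in $\Gamma$ if moreover, for all $r\in\Gamma$ and $c,d,d'$: if $r[c,d]\Vdash\wr\bullet P$, $r[d,d']\Vdash\wr\bullet S$ and $d$ is finite, then $d'$ is finite. BSLs. A program is straight-line if it is built from sends, receives and assignments using layering only. It is balanced if, whenever $r\in\mathrm{Rel}$, $r[c,d]\Vdash P$ and all channels are empty at $(r,c)$, every channel contains an equal number of sends and receives at $(r,d)$. Deadlock-free: executed from empty channels (processes step one at a time, a receive blocks until a message is available on its channel), the program never reaches a point where it is unfinished and cannot progress. Program graph of a BSL: the directed graph with a node for every send and receive event of the program plus dummy nodes $\mathsf{fst}_i$ (first) and $\mathsf{lst}_i$ (last) for each process $i$. Edges: the immediate-successor relation over events of the same process, extended so that $\mathsf{fst}_i$ comes first and $\mathsf{lst}_i$ last for process $i$; and an edge from the $k$-th send to the $k$-th receive on channel $\mathsf{chan}_{i\to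 j}$, for all $i,j,k$. Signature $\mathrm{Sig}(P)=(V,E)$ of a BSL $P$: let $E_0^+$ be the irreflexive transitive closure of the edge relation of the program graph of $P$. $V$ consists of all dummy nodes and, for each channel $\mathsf{chan}_{i\to j}$ used by $P$, its first send (denoted $\mathsf{snd}^{i\to j}$) and its last receive (denoted $\mathsf{rcv}^{j\leftarrow i}$), except that $\mathsf{snd}^{i\to j}$ is removed whenever $(\mathsf{fst}_j,\mathsf{snd}^{i\to j})\in E_0^+$ and $\mathsf{rcv}^{j\leftarrow i}$ is removed whenever $(\mathsf{rcv}^{j\leftarrow i},\mathsf{lst}_i)\in E_0^+$. $E=E_0^+\cap V^2$. *)

(* Defs.v *)
From Stdlib Require Import Relation_Operators.
From mathcomp Require Import all_boot all_order ssralg ssrint.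
From mathcomp Require Import classical_sets cardinality.

Set Implicit Arguments.
Unset Strict Implicit.
Unset Printing Implicit Defensive.

Local Open Scope classical_set_scope.

Inductive expr (X : Type) : Type :=
| EConst of int
| EVar of X
| EAdd of expr X & expr X
| ESub of expr X & expr X
| EMul of expr X & expr X.

Fixpoint eval (X : Type) (s : X -> int) (e : expr X) : int :=
  match e with
  | EConst z => z
  | EVar x => s x
  | EAdd a b => (eval s a + eval s b)%R
  | ESub a b => (eval s a - eval s b)%R
  | EMul a b => (eval s a * eval s b)%R
  end.

Definition upd (A : eqType) (B : Type) (f : A -> B) (a : A) (b : B) : A -> B :=
  fun x => if x == a then b else f x.

(* The set N + {oo}. *)
Inductive natinf : Type := Fin of nat | Inf.

Definition le_natinf (a b : natinf) : bool :=
  match a, b with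
  | _, Inf => true
  | Fin k, Fin l => k <= l
  | Inf, Fin _ => false
  end.

Section Programs.
(* The processes are the elements of 'I_n; indexing the variables by their
   process makes the sets of variables mutually disjoint. *)
Context {n : nat} {Var : 'I_n -> eqType}.

(* [Snd i j e] is the send of i to j, and [Rcv j i x] is the receive of j
   from i into the variable x of j. *)
Inductive prog : Type :=
| Eps
| Asgn (i : 'I_n) (x : Var i) (e : expr (Var i))
| Snd (i j : 'I_n) (e : expr (Var i))
| Rcv (j i : 'I_n) (x : Var j)
| Cut
| Layer (P Q : prog).

(* Records of the history of a process i: [HSnd j v] is (i -> j, v) and
   [HRcv j v] is (i <- j, v). *)
Inductive hrec : Type := HSnd (j : 'I_n) (v : int) | HRcv (j : 'I_n) (v : int).

Record lstate (i : 'I_n) : Type :=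
  LState { store : Var i -> int; hist : seq hrec }.

Definition set_var i (s : lstate i) (x : Var i) (v : int) : lstate i :=
  LState (upd (store s) x v) (hist s).

Definition log i (s : lstate i) (h : hrec) : lstate i :=
  LState (store s) (rcons (hist s) h).

(* [(i, k)] with 0 < k is the event of i with index k, i.e. the transition
   from the local state k - 1 to the local state k of i. *)
Definition event : Type := ('I_n * nat)%type.

(* [delta] is only meaningful on receive events; it is arbitrary elsewhere. *)
Record prerun : Type :=
  PreRun { lrun : forall i : 'I_n, nat -> lstate i; delta : event -> event }.

Section Events.
Variable r : prerun.

Definition appends (e : event) (h : hrec) : Prop :=
  0 < e.2 /\ hist (lrun r e.1 e.2) = rcons (hist (lrun r e.1 e.2.-1)) h.

Definition internal (e : event) : Prop :=
  0 < e.2 /\ hist (lrun r e.1 e.2) = hist (lrun r e.1 e.2.-1).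

Definition sends_to (e : event) (j : 'I_n) : Prop :=
  exists v, appends e (HSnd j v).

Definition receives_from (e : event) (i : 'I_n) : Prop :=
  exists v, appends e (HRcv i v).

Definition is_send (e : event) : Prop := exists j, sends_to e j.
Definition is_receive (e : event) : Prop := exists i, receives_from e i.

(* e is a receive event which delta maps to e'. *)
Definition delta_pair (e e' : event) : Prop := is_receive e /\ delta r e = e'.

Definition matched_with (e e' : event) : Prop :=
  delta_pair e e' \/ delta_pair e' e.

Definition causal_step (e e' : event) : Prop :=
  [/\ e.1 = e'.1, 0 < e.2 & e.2 < e'.2] \/ delta_pair e' e.

Definition lamport : event -> event -> Prop := clos_trans event causal_step.

Definition is_run : Prop :=
  [/\ forall e : event, 0 < e.2 -> [\/ is_send e, is_receive e | internal e],
      forall e e', is_receive e -> is_receive e' -> delta r e = delta r e' ->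
        e = e',
      forall e i v, appends e (HRcv i v) ->
        (delta r e).1 = i /\ appends (delta r e) (HSnd e.1 v)
    & forall e, ~ lamport e e].

End Events.

Record run : Type := Run { run_pre :> prerun; runP : is_run run_pre }.

Definition is_matched (r : run) (e : event) : Prop :=
  exists e', matched_with r e e'.

Definition Rel : set run :=
  [set r : run | forall (i j : 'I_n) (k : nat),
     sends_to r (i, k) j -> ~ is_matched r (i, k) ->
     finite_set
       [set l : nat | k < l /\ sends_to r (i, l) j /\ is_matched r (i, l)]].

Definition cut : Type := 'I_n -> natinf.

Definition cut_le (c d : cut) : Prop := forall i, le_natinf (c i) (d i).

Definition finite_cut (c : cut) : Prop := forall i, c i <> Inf.

Definition in_cut (c : cut) (e : event) : Prop :=
  0 < e.2 /\ le_natinf (Fin e.2) (c e.1).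

Definition chan_sends (r : run) (c : cut) (i j : 'I_n) : set event :=
  [set e | [/\ in_cut c e, e.1 = i, sends_to r e j
           & ~ exists e', matched_with r e e' /\ in_cut c e']].

Definition chan_receives (r : run) (c : cut) (i j : 'I_n) : set event :=
  [set e | [/\ in_cut c e, e.1 = j, receives_from r e i
           & ~ exists e', matched_with r e e' /\ in_cut c e']].

Definition chan (r : run) (c : cut) (i j : 'I_n) : set event :=
  chan_sends r c i j `|` chan_receives r c i j.

(* d = c[i |-> c_i + 1], where c_i = k is finite, so that the local states of
   i at c and at d exist. *)
Definition advances (c d : cut) (i : 'I_n) (k : nat) : Prop :=
  c i = Fin k /\ d = upd c i (Fin k.+1).

Fixpoint occurs (P : prog) (r : run) (c d : cut) : Prop :=
  match P with
  | Eps => c = d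
  | @Asgn i x e =>
      exists2 k, advances c d i k &
        let s := lrun r i k in
        lrun r i k.+1 = set_var s x (eval (store s) e)
  | @Snd i j e =>
      exists2 k, advances c d i k &
        let s := lrun r i k in
        lrun r i k.+1 = log s (HSnd j (eval (store s) e))
  | @Rcv j i x =>
      exists2 k, advances c d j k &
        exists v, lrun r j k.+1 = set_var (log (lrun r j k) (HRcv i v)) x v
  | Cut =>
      c = d /\
      forall e e', in_cut c e -> matched_with r e e' -> in_cut c e'
  | Layer P1 P2 =>
      exists c', [/\ cut_le c c', cut_le c' d, occurs P1 r c c'
                   & occurs P2 r c' d]
  end.

Definition refines (G : set run) (P Q : prog) : Prop :=
  forall r, G r -> forall c d, occurs P r c d -> occurs Q r c d.

Definition seals (G : set run) (S P : prog) : Prop :=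
  refines G (Layer (Layer Cut P) S) (Layer (Layer P Cut) S).

Definition properly_seals (G : set run) (S P : prog) : Prop :=
  seals G S P /\
  forall r, G r -> forall c d d',
    occurs (Layer Cut P) r c d -> occurs (Layer Cut S) r d d' ->
    finite_cut d -> finite_cut d'.

Fixpoint straight_line (P : prog) : bool :=
  match P with
  | Asgn _ _ _ | Snd _ _ _ | Rcv _ _ _ => true
  | Layer P1 P2 => straight_line P1 && straight_line P2
  | Eps | Cut => false
  end.

Definition balanced (P : prog) : Prop :=
  forall r c d, Rel r -> occurs P r c d ->
    (forall i j, chan r c i j = set0) ->
    forall i j, (chan_sends r d i j #= chan_receives r d i j)%card.

Definition BSL (P : prog) : Prop := straight_line P /\ balanced P.

(* The actions of one process: a local step, a send to j, a receive from j. *)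
Inductive act : Type := AInt | ASnd (j : 'I_n) | ARcv (j : 'I_n).

Definition is_comm (a : act) : bool := if a is AInt then false else true.
Definition is_snd (j : 'I_n) (a : act) : bool :=
  if a is ASnd j' then j' == j else false.
Definition is_rcv (j : 'I_n) (a : act) : bool :=
  if a is ARcv j' then j' == j else false.

(* The actions of process i in P, in program order. *)
Fixpoint acts (P : prog) (i : 'I_n) : seq act :=
  match P with
  | Asgn i' _ _ => if i' == i then [:: AInt] else [::]
  | Snd i' j _ => if i' == i then [:: ASnd j] else [::]
  | Rcv i' j _ => if i' == i then [:: ARcv j] else [::]
  | Layer P1 P2 => acts P1 i ++ acts P2 i
  | Eps | Cut => [::]
  end.

(* A configuration consists of the remaining actions of every process and of
   the number of messages in every channel (i, j) from i to j. Values are left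
   out, since whether an action of a straight-line program can be executed
   does not depend on them. *)
Definition config : Type :=
  (('I_n -> seq act) * ('I_n * 'I_n -> nat))%type.

Inductive step : config -> config -> Prop :=
| step_int t m i s :
    t i = AInt :: s ->
    step (t, m) (upd t i s, m)
| step_snd t m i j s :
    t i = ASnd j :: s ->
    step (t, m) (upd t i s, upd m (i, j) (m (i, j)).+1)
| step_rcv t m i j s :
    t j = ARcv i :: s -> 0 < m (i, j) ->
    step (t, m) (upd t j s, upd m (i, j) (m (i, j)).-1).

Definition deadlock_free (P : prog) : Prop :=
  forall s, clos_refl_trans config step (acts P, fun=> 0) s ->
    (forall i, s.1 i = [::]) \/ exists s', step s s'.

Definition comms (P : prog) (i : 'I_n) : seq act :=
  [seq a <- acts P i | is_comm a].

(* [NEv i p], with p < size (comms P i), is the send or receive event of i at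
   position p, counted from 0, of [comms P i]. *)
Inductive node : Type := NFst (i : 'I_n) | NEv (i : 'I_n) (p : nat)
                       | NLst (i : 'I_n).

(* The event at position p of process i is the k-th send to (the k-th receive
   from) j, with k counted from 0. *)
Definition nth_snd (P : prog) (i j : 'I_n) (k p : nat) : Prop :=
  onth (comms P i) p = Some (ASnd j) /\
  count (is_snd j) (take p (comms P i)) = k.

Definition nth_rcv (P : prog) (i j : 'I_n) (k p : nat) : Prop :=
  onth (comms P i) p = Some (ARcv j) /\
  count (is_rcv j) (take p (comms P i)) = k.

Inductive edge (P : prog) : node -> node -> Prop :=
| edge_fst i : 0 < size (comms P i) -> edge P (NFst i) (NEv i 0)
| edge_fst_lst i : size (comms P i) = 0 -> edge P (NFst i) (NLst i)
| edge_succ i p : p.+1 < size (comms P i) -> edge P (NEv i p) (NEv i p.+1)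
| edge_lst i p : p.+1 = size (comms P i) -> edge P (NEv i p) (NLst i)
| edge_msg i j k p q :
    nth_snd P i j k p -> nth_rcv P j i k q -> edge P (NEv i p) (NEv j q).

(* Names for the nodes of signatures; what [GSnd] and [GRcv] name depends on
   the program and is given by [denotes]. *)
Inductive signode : Type :=
| GFst (i : 'I_n) | GLst (i : 'I_n) | GSnd (i j : 'I_n) | GRcv (j i : 'I_n).

Definition denotes (P : prog) (a : signode) (u : node) : Prop :=
  match a with
  | GFst i => u = NFst i
  | GLst i => u = NLst i
  | GSnd i j => exists2 p, u = NEv i p & nth_snd P i j 0 p
  | GRcv j i => exists2 p, u = NEv j p &
      onth (comms P j) p = Some (ARcv i) /\
      ~~ has (is_rcv i) (drop p.+1 (comms P j))
  end.

Definition E0plus (P : prog) (a b : signode) : Prop :=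
  exists u v,
    [/\ denotes P a u, denotes P b v & clos_trans node (edge P) u v].

Definition sigV (P : prog) : set signode :=
  [set a | match a with
           | GFst _ | GLst _ => True
           | GSnd i j => (exists u, denotes P a u) /\ ~ E0plus P (GFst j) a
           | GRcv j i => (exists u, denotes P a u) /\ ~ E0plus P a (GLst i)
           end].

Definition sigE (P : prog) : set (signode * signode) :=
  [set ab | [/\ sigV P ab.1, sigV P ab.2 & E0plus P ab.1 ab.2]].

Definition Sig (P : prog) : set signode * set (signode * signode) :=
  (sigV P, sigE P).

End Programs.

Arguments prog {n} Var.
Arguments run {n} Var.

(* Main.v *)
(* A straight-line program P run from a sealed cut c to d leaves d sealed unless
   some receive of P gets its message from a send after d: channels are
   balanced, so otherwise the receives of P use up all sends of P.

   Although messages may be reordered or lost, the first k+1 receives on a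
   channel can never all be matched with the first k sends. Hence the k-th send
   causally precedes the k-th receive in every run, and paths of the program
   graph are causal chains. If a receive of P from i were matched with a send of
   i after P, the paths provided by (a), (b), (c), or by the absence of the
   receive or the send from the signature, would close a causal cycle.

   Conversely, if the conditions fail for rcv^(j<-i), match that receive with
   the first send i -> j of Q or, if no process reached from the receive leads
   to lst_i in Q, with an extra send i -> j after Q. Deadlock freedom provides a
   linear extension of the program graph; delaying all that is reachable from
   the receive past the new send makes it a linear extension for the new
   matching, which is therefore realized by a run. *)
From Stdlib Require Import Relation_Operators Operators_Properties.
Require Import Defs.
From mathcomp Require Import all_boot ssralg ssrint.
From mathcomp Require Import boolp classical_sets cardinality.
From mathcomp Require Import zify.

Set Implicit Arguments.
Unset Strict Implicit.
Unset Printing Implicit Defensive.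

(** * Positions of the n-th element satisfying a predicate *)

Section Positions.
Context {T : Type}.
Implicit Types (a b : pred T) (s t : seq T).

(** Counting in two consecutive prefixes needs no default element and turns concatenation and
    filtering into arithmetic. *)
Definition nthp a s (n p : nat) : Prop :=
  count a (take p s) = n /\ count a (take p.+1 s) = n.+1.

Lemma count_take_le a s p q : p <= q -> count a (take p s) <= count a (take q s).
Proof.
move=> pq; rewrite -(take_takel s pq) -{2}(cat_take_drop p (take q s)).
by rewrite count_cat leq_addr.
Qed.

Lemma nthp_size a s n p : nthp a s n p -> p < size s.
Proof.
move=> [h1 h2]; rewrite ltnNge; apply/negP => sp.
by move: h1 h2; rewrite !take_oversize ?(leqW sp)// => ->; lia.
Qed.

Lemma nthpP x0 a s n p :
  nthp a s n p <-> [/\ p < size s, a (nth x0 s p) & count a (take p s) = n].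
Proof.
split=> [h|[ps ap <-]]; last first.
  by split=> //; rewrite (take_nth x0 ps) -cats1 count_cat /= ap addn0 addn1.
have ps := nthp_size h; case: h => h1; rewrite (take_nth x0 ps) -cats1 count_cat /= h1.
by case: (a _) => // g; split=> //; lia.
Qed.

Lemma nthp_count a s n p : nthp a s n p -> n < count a s.
Proof. by move=> [_ <-]; rewrite -{2}(cat_take_drop p.+1 s) count_cat leq_addr. Qed.

Lemma nthp_lt a s n m p q : nthp a s n p -> nthp a s m q -> (n < m) = (p < q).
Proof.
move=> [h1 h2] [g1 g2]; apply/idP/idP => h.
  rewrite ltnNge; apply/negP => /(count_take_le a s); lia.
by move: (count_take_le a s h); lia.
Qed.

Lemma nthp_uniq a s n p q : nthp a s n p -> nthp a s n q -> p = q.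
Proof.
move=> h g; move: (nthp_lt h g) (nthp_lt g h); rewrite ltnn => h1 h2; lia.
Qed.

Lemma nthp_ex a s n : n < count a s -> exists p, nthp a s n p.
Proof.
elim: s n => [|x s IH] n //=; case ax: (a x) => /=.
  case: n => [_|n]; first by exists 0; split=> //=; rewrite take0 ax.
  rewrite add1n ltnS => /IH [p [h1 h2]]; exists p.+1.
  by split; rewrite /= ax ?h1 ?h2.
rewrite add0n => /IH [p [h1 h2]]; exists p.+1.
by split; rewrite /= ax ?h1 ?h2.
Qed.

Lemma nthp_cons a x s n p : nthp a (x :: s) n p ->
  (p = 0 /\ n = 0 /\ a x) \/
  (exists p' n', [/\ p = p'.+1, n = a x + n' & nthp a s n' p']).
Proof.
case: p => [|p] [] /=; rewrite ?take0 /=.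
  by move=> <-; rewrite addn0; case: (a x) => //; left.
by move=> <- h; right; exists p, (count a (take p s)); split=> //; split=> //; lia.
Qed.

Lemma nthp_catl a s t n p : nthp a s n p -> nthp a (s ++ t) n p.
Proof.
move=> h; have ps := nthp_size h.
by rewrite /nthp !takel_cat // ltnW.
Qed.

Lemma nthp_catr a s t n p :
  nthp a t n p -> nthp a (s ++ t) (count a s + n) (size s + p).
Proof.
move=> [h1 h2]; split; rewrite take_cat ltnNge.
  by rewrite leq_addr /= addKn count_cat h1.
by rewrite -addnS leq_addr /= addKn count_cat h2 addnS.
Qed.

Lemma nthp_cat a s t n p : nthp a (s ++ t) n p ->
  nthp a s n p \/
  exists n' p', [/\ n = count a s + n', p = size s + p' & nthp a t n' p'].
Proof.
move=> g; case: (ltnP p (size s)) => h.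
  by left; move: g; rewrite /nthp !takel_cat // ltnW.
right; exists (n - count a s), (p - size s).
case: g; rewrite !take_cat !ltnNge h leqW //= subSn // !count_cat.
move=> <- g; rewrite addKn subnKC //; split=> //.
by split=> //; lia.
Qed.

Lemma take_filter b s p :
  take (count b (take p s)) (filter b s) = filter b (take p s).
Proof.
by rewrite -{2}(cat_take_drop p s) filter_cat -size_filter take_size_cat.
Qed.

(** Relates nodes of the program graph, which number communications only, to positions in [acts]. *)
Lemma nthp_filter a b s n q p : subpred a b -> nthp b s q p ->
  nthp a (filter b s) n q <-> nthp a s n p.
Proof.
move=> ab [h1 h2].
have E u : count a (filter b u) = count a u.
  by rewrite count_filter; apply: eq_count => x /=; case ax: (a x) => //=; rewrite ab.
by rewrite /nthp -h2 -{1}h1 !take_filter !E.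
Qed.

Lemma nthp_sub a b s n p : subpred a b -> nthp a s n p ->
  nthp b s (count b (take p s)) p.
Proof.
move=> ab h; case: s h => [|x0 s] h; first by move: (nthp_size h).
by move: h => /(nthpP x0) [ps ap _]; apply/(nthpP x0); split=> //; apply: ab.
Qed.

Lemma count_nth_iota x0 a s m : ~~ a x0 ->
  count (fun q => a (nth x0 s q)) (iota 0 m) = count a (take m s).
Proof.
move=> ax; elim: m => [|m IH]; first by rewrite take0.
rewrite -addn1 iotaD count_cat IH /= add0n addn0 addn1.
case: (ltnP m (size s)) => h.
  by rewrite (take_nth x0 h) -cats1 count_cat /= addn0.
by rewrite nth_default // (negPf ax) addn0 !take_oversize // leqW.
Qed.

(* [X] consists of further positions, not in the image of [f]. *)
Lemma count_take_inj x0 a b s t m m' (f : nat -> nat) (X : seq nat) :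
    ~~ a x0 -> ~~ b x0 -> uniq X ->
    {in X, forall x, x < m' /\ b (nth x0 t x)} ->
    (forall q, q < m -> a (nth x0 s q) ->
      [/\ f q < m', b (nth x0 t (f q)) & f q \notin X]) ->
    (forall q q', q < m -> a (nth x0 s q) -> q' < m -> a (nth x0 s q') ->
      f q = f q' -> q = q') ->
  size X + count a (take m s) <= count b (take m' t).
Proof.
move=> ax bx uX hX hf inj.
rewrite -!(count_nth_iota _ _ ax) -!(count_nth_iota _ _ bx) -!size_filter.
set A := filter _ (iota 0 m).
have mA q : q \in A -> q < m /\ a (nth x0 s q).
  by rewrite mem_filter mem_iota add0n => /andP [].
rewrite -(size_map f A) -size_cat; apply: uniq_leq_size.
  rewrite cat_uniq uX /=; apply/andP; split.
    by apply/hasPn => _ /mapP [q /mA [h1 h2] ->]; case: (hf q h1 h2).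
  rewrite map_inj_in_uniq ?filter_uniq ?iota_uniq //.
  by move=> q q' /mA [? ?] /mA [? ?]; apply: inj.
move=> x; rewrite mem_cat mem_filter mem_iota add0n => /orP [/hX [-> ->] //|].
by move=> /mapP [q /mA [h1 h2] ->]; case: (hf q h1 h2) => -> ->.
Qed.

End Positions.

(** * Sends and receives in the action sequence of a process *)

Section Actions.
Context {n : nat}.
Implicit Types (s : seq (@act n)) (i j : 'I_n).

Lemma is_sndP j (a : @act n) : is_snd j a -> a = ASnd j.
Proof. by case: a => //= k /eqP ->. Qed.

Lemma is_rcvP j (a : @act n) : is_rcv j a -> a = ARcv j.
Proof. by case: a => //= k /eqP ->. Qed.

Lemma snd_comm j : subpred (is_snd j) (@is_comm n).
Proof. by case. Qed.

Lemma rcv_comm j : subpred (is_rcv j) (@is_comm n).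
Proof. by case. Qed.

Lemma nthp_snd s j k p : nthp (is_snd j) s k p -> nth AInt s p = ASnd j.
Proof. by case/(nthpP AInt) => _ /is_sndP. Qed.

Lemma nthp_rcv s j k p : nthp (is_rcv j) s k p -> nth AInt s p = ARcv j.
Proof. by case/(nthpP AInt) => _ /is_rcvP. Qed.

Lemma nth_size s p : nth AInt s p <> AInt -> p < size s.
Proof. by move=> h; rewrite ltnNge; apply/negP => /(nth_default AInt). Qed.

Lemma snd_nthp s j p : nth AInt s p = ASnd j ->
  nthp (is_snd j) s (count (is_snd j) (take p s)) p.
Proof.
move=> h; apply/(nthpP AInt); split=> //; last by rewrite h /= eqxx.
by apply: nth_size; rewrite h.
Qed.

Lemma rcv_nthp s j p : nth AInt s p = ARcv j ->
  nthp (is_rcv j) s (count (is_rcv j) (take p s)) p.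
Proof.
move=> h; apply/(nthpP AInt); split=> //; last by rewrite h /= eqxx.
by apply: nth_size; rewrite h.
Qed.

Lemma onth_SomeP T (x0 : T) (s : seq T) p x :
  onth s p = Some x <-> p < size s /\ nth x0 s p = x.
Proof.
elim: s p => [|y s IH] [|p] /=; try by [split=> [|[]]].
  by split=> [[->]|[_ ->]].
by rewrite IH ltnS.
Qed.

End Actions.

(** * Schedules of deadlock-free programs *)

Section Schedules.
Context {n : nat}.
Notation config := (@config n).
Implicit Types (s : config) (i j : 'I_n).

(* A schedule is a linear extension of the program graph of the remaining
   actions, whose receives first consume the messages already in transit. *)
Definition schedule s (rk : 'I_n -> nat -> nat) : Prop :=
  (forall i p q, p < q -> rk i p < rk i q) /\
  (forall i j k p q, nthp (is_snd j) (s.1 i) k p ->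
     nthp (is_rcv i) (s.1 j) (s.2 (i, j) + k) q -> rk i p < rk j q).

Definition schedulable s : Prop := exists rk, schedule s rk.

(** One description for all three kinds of steps: process [i0] executes [x]. The channel equation is
    additive to avoid truncated subtraction. *)
Lemma step_inv s s' : step s s' ->
  exists i0 x, [/\ s.1 i0 = x :: s'.1 i0, forall k, k != i0 -> s.1 k = s'.1 k
    & forall i j, s'.2 (i, j) + ((i0 == j) && is_rcv i x) =
                  s.2 (i, j) + ((i0 == i) && is_snd j x)].
Proof.
case=> [t m i u|t m i j u|t m i j u] ti /=.
- exists i, AInt; split=> [|k /negPf ki|? ?]; rewrite /upd ?eqxx ?ki //=.
  by rewrite !andbF.
- exists i, (ASnd j); split=> [|k /negPf ki|i' j']; rewrite /upd ?eqxx ?ki //=.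
  rewrite andbF addn0 xpair_eqE (eq_sym i') (eq_sym j').
  by case: (eqVneq i i') => [<-|_]; case: (eqVneq j j') => [<-|_] /=; rewrite ?addn0 ?addn1.
- move=> mi; exists j, (ARcv i); split=> [|k /negPf ki|i' j']; rewrite /upd ?eqxx ?ki //=.
  rewrite andbF addn0 xpair_eqE (eq_sym i') (eq_sym j').
  case: (eqVneq i i') => [<-|_]; case: (eqVneq j j') => [<-|_] /=;
    rewrite ?addn0 //.
  by rewrite addn1 prednK.
Qed.

Lemma step_nthp s s' i0 x a i k p :
    s.1 i0 = x :: s'.1 i0 -> (forall k, k != i0 -> s.1 k = s'.1 k) ->
    nthp a (s.1 i) k p ->
  [/\ i = i0, p = 0, k = 0 & a x] \/
  exists k' p', [/\ k = ((i0 == i) && a x) + k', nthp a (s'.1 i) k' p' &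
     p = (i0 == i) + p'].
Proof.
move=> e1 e2; case: (eqVneq i i0) => [->|ni] h.
  rewrite e1 in h; have [[-> [-> ax]]|[p' [k' [-> -> h']]]] := nthp_cons h; first by left.
  by right; exists k', p'; split=> //; rewrite eqxx.
by move: h; rewrite e2 // => h; right; exists k, p; split=> //; rewrite eq_sym (negPf ni).
Qed.

(** The executed action is ranked first and all other ranks are shifted by one. *)
Lemma step_schedulable s s' : step s s' -> schedulable s' -> schedulable s.
Proof.
move=> /step_inv [i0 [x [e1 e2 e3]]] [rk [mono fifo]].
pose rk' i p := if i == i0 then (if p is p'.+1 then (rk i p').+1 else 0)
                else (rk i p).+1.
have rkE i p : rk' i ((i0 == i) + p) = (rk i p).+1.
  by rewrite /rk' eq_sym; case: eqP.
exists rk'; split=> [i p q pq|i j k p q hp hq].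
  rewrite /rk'; case: eqP => [_|_]; last by rewrite ltnS mono.
  by case: q pq => // q; case: p => // p; rewrite !ltnS => /mono.
have E := e3 i j.
have [[ii p0 _ ax]|[k1 [p1 [Ek hp1 ->]]]] := step_nthp e1 e2 hp.
  have [[_ _ _ bx]|[_ [q1 [_ _ ->]]]] := step_nthp e1 e2 hq.
    by case: (x) ax bx.
  by rewrite rkE /rk' ii p0 eqxx.
(* A receive executed first takes a message in transit, so it is not matched with a remaining
   send. *)
have [[jj q0 k0 bx]|[k2 [q1 [Ek2 hq1 ->]]]] := step_nthp e1 e2 hq.
  move: E; rewrite jj eqxx bx /= -jj.
  by case: (x) bx => //= ? _; rewrite andbF; lia.
rewrite !rkE ltnS; apply: fifo hp1 _.
suff -> : s'.2 (i, j) + k1 = k2 by [].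
by move: E Ek Ek2; lia.
Qed.

Lemma step_cat s s' (u : 'I_n -> seq act) : step s s' ->
  step (fun i => s.1 i ++ u i, s.2) (fun i => s'.1 i ++ u i, s'.2).
Proof.
have E t0 i w : (fun k => upd t0 i w k ++ u k)
              = upd (fun k => t0 k ++ u k) i (w ++ u i).
  by apply: funext => k; rewrite /upd; case: eqP => // ->.
by case=> [t m i w|t m i j w|t m i j w] ti => [|| mi] /=; rewrite E;
  constructor; rewrite // ti.
Qed.

(** Backward induction along the execution; the frame [u] holds the actions that follow the executed
    program. *)
Lemma steps_schedulable s s' (u : 'I_n -> seq act) :
    clos_refl_trans_1n config step s s' ->
  schedulable (fun i => s'.1 i ++ u i, s'.2) ->
  schedulable (fun i => s.1 i ++ u i, s.2).
Proof.
elim=> // {}s {}s' s'' st _ IH /IH; apply: step_schedulable.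
exact: step_cat.
Qed.

(** Conservation law: messages in transit plus sends to come minus receives to come is invariant. *)
Lemma steps_count s s' i j : clos_refl_trans_1n config step s s' ->
  s.2 (i, j) + count (is_snd j) (s.1 i) + count (is_rcv i) (s'.1 j) =
  s'.2 (i, j) + count (is_snd j) (s'.1 i) + count (is_rcv i) (s.1 j).
Proof.
elim=> // {}s {}s' s'' /step_inv [i0 [x [e1 e2 e3]]] _.
have E a k : count a (s.1 k) = ((i0 == k) && a x) + count a (s'.1 k).
  by case: (eqVneq i0 k) => [<-|nk] /=; rewrite ?e1 // e2 // eq_sym.
by move: (e3 i j); rewrite !E; lia.
Qed.

Lemma step_measure s s' : step s s' ->
  \sum_i size (s.1 i) = (\sum_i size (s'.1 i)).+1.
Proof.
move=> /step_inv [i0 [x [e1 e2 _]]].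
rewrite (bigD1 i0) // (bigD1 (F := fun i => size (s'.1 i)) i0) //= e1 /=.
by rewrite addSn (eq_bigr (fun i => size (s'.1 i))) // => i /e2 ->.
Qed.

(** Every step removes an action, so stepping as long as possible terminates, and by deadlock
    freedom nothing is then left to do. *)
Lemma deadlock_free_completes {Var : 'I_n -> eqType} (P : prog Var) :
  deadlock_free P -> exists m,
    clos_refl_trans_1n config step (acts P, fun=> 0) (fun=> [::], m).
Proof.
move=> dfP.
have key N : forall s, clos_refl_trans config step (acts P, fun=> 0) s ->
    \sum_i size (s.1 i) < N ->
    exists m, clos_refl_trans config step (acts P, fun=> 0) (fun=> [::], m).
  elim: N => // N IH s hs sN; have [fin|[s' st]] := dfP s hs.
    exists s.2; suff -> : (fun=> [::], s.2) = s by [].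
    by case: s fin {hs sN} => t m /= fin; congr (_, _); apply: funext.
  apply: (IH s'); first by apply: rt_trans hs _; apply: rt_step.
  by move: (step_measure st); lia.
have [m hm] := key _ _ (rt_refl _ _ _) (leqnn _).
by exists m; apply: clos_rt_rt1n.
Qed.

End Schedules.

(** * Occurrences as sequences of local events *)

Section Occurrences.
Context {n : nat} {Var : 'I_n -> eqType}.
Implicit Types (P : prog Var) (r : prerun (Var := Var)) (e : @event n).

Definition does r e (a : act) : Prop :=
  match a with
  | AInt => internal r e
  | ASnd j => sends_to r e j
  | ARcv i => receives_from r e i
  end.

Lemma does_inj r e a b : does r e a -> does r e b -> a = b.
Proof.
have R (s : seq (@hrec n)) x : rcons s x = s -> False.
  by move/(congr1 size); rewrite size_rcons; lia.
have I (s : seq (@hrec n)) x y : rcons s x = rcons s y -> x = y.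
  by move/rcons_inj => [].
case: a => [|j|j]; case: b => [|k|k] //=; rewrite /internal /sends_to /receives_from /appends.
- by move=> [_ ->] [v [_ /esym/R]].
- by move=> [_ ->] [v [_ /esym/R]].
- by move=> [v [_ ->]] [_ /R].
- by move=> [v [_ ->]] [w [_ /I [-> _]]].
- by move=> [v [_ ->]] [w [_ /I]].
- by move=> [v [_ ->]] [_ /R].
- by move=> [v [_ ->]] [w [_ /I]].
- by move=> [v [_ ->]] [w [_ /I [-> _]]].
Qed.

(** Reduces an occurrence to the number and kinds of the events of each process. A process at
    infinity cannot advance, hence has no actions in [P]. *)
Lemma occurs_acts P (r : run Var) c d i : occurs P r c d ->
  match c i with
  | Fin k => d i = Fin (k + size (acts P i)) /\
      forall p, p < size (acts P i) ->
        does r (i, (k + p).+1) (nth AInt (acts P i) p)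
  | Inf => d i = Inf /\ acts P i = [::]
  end.
Proof.
have base c' d' i0 k (a : act) : advances c' d' i0 k -> does r (i0, k.+1) a ->
    match c' i with
    | Fin k => d' i = Fin (k + size (if i0 == i then [:: a] else [::])) /\
      forall p, p < size (if i0 == i then [:: a] else [::]) ->
        does r (i, (k + p).+1) (nth AInt (if i0 == i then [:: a] else [::]) p)
    | Inf => d' i = Inf /\ (if i0 == i then [:: a] else [::]) = [::]
    end.
  move=> [ck ->] h; rewrite /upd eq_sym; case: (eqVneq i0 i) => [<-|_].
    by rewrite ck addn1; split=> // -[|//] _; rewrite addn0.
  by case: (c' i) => [l|]; rewrite ?addn0.
elim: P c d => [|i0 x e|i0 j e|i0 j x||P IHP Q IHQ] c d /=.
- by move=> ->; case: (d i) => [k|]; rewrite ?addn0.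
- by move=> [k adv E]; apply: (base _ _ _ _ AInt adv) => /=; rewrite /internal /= E.
- move=> [k adv E]; apply: (base _ _ _ _ (ASnd j) adv) => /=.
  by rewrite /sends_to /appends /= E; eexists.
- move=> [k adv [v E]]; apply: (base _ _ _ _ (ARcv j) adv) => /=.
  by rewrite /receives_from /appends /= E; eexists.
- by move=> [-> _]; case: (d i) => [k|]; rewrite ?addn0.
- move=> [c' [_ _ /IHP h1 /IHQ]]; move: h1.
  case: (c i) => [k|] [-> h1]; last by rewrite h1.
  move=> [-> h2]; split; first by rewrite size_cat addnA.
  move=> p; rewrite size_cat nth_cat => hp; case: ltnP => h; first exact: h1.
  by rewrite -{1}(subnKC h) addnA; apply: h2; lia.
Qed.

End Occurrences.

(** * Realizing a matching by a run *)

Section RunConstruction.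
Context {n : nat} {Var : 'I_n -> eqType}.
Notation event := (@event n).
Notation lstate := (@lstate n Var).
Implicit Types (P : prog Var) (i j : 'I_n).

(* The integer is the received value; only receives use it. *)
Definition instr i : Type := (@act n * (lstate i -> int -> lstate i))%type.

Definition skip i : instr i := (AInt, fun s _ => s).

Definition at_proc k (x : instr k) i : seq (instr i) :=
  match k =P i with
  | ReflectT E => [:: eq_rect k instr x i E]
  | ReflectF _ => [::]
  end.

Lemma at_proc_same k (x : instr k) : at_proc x k = [:: x].
Proof. by rewrite /at_proc; case: eqP => // E; rewrite eq_axiomK. Qed.

Lemma at_proc_diff k (x : instr k) i : k != i -> at_proc x i = [::].
Proof. by rewrite /at_proc; case: eqP. Qed.

Fixpoint instrs P i : seq (instr i) :=
  match P with
  | Asgn k x e =>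
      at_proc (AInt, fun s _ => set_var s x (eval (store s) e) : lstate k) i
  | Snd k j e =>
      at_proc (ASnd j, fun s _ => log s (HSnd j (eval (store s) e)) : lstate k) i
  | Rcv k j x =>
      at_proc (ARcv j, fun s v => set_var (log s (HRcv j v)) x v : lstate k) i
  | Layer P1 P2 => instrs P1 i ++ instrs P2 i
  | Eps | Cut => [::]
  end.

Lemma map_instrs P i : [seq f.1 | f <- instrs P i] = acts P i.
Proof.
elim: P => [|k x e|k j e|k j x||P IHP Q IHQ] //=; last by rewrite map_cat IHP IHQ.
all: by case: (eqVneq k i) => [<-|ki]; rewrite ?at_proc_same ?at_proc_diff.
Qed.

Definition honest i (f : instr i) : Prop := forall s v,
  match f.1 with
  | AInt => hist (f.2 s v) = hist s
  | ASnd j => exists w, hist (f.2 s v) = rcons (hist s) (HSnd j w)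
  | ARcv j => hist (f.2 s v) = rcons (hist s) (HRcv j v)
  end.

Lemma honest_instr P i p : honest (nth (skip i) (instrs P i) p).
Proof.
have base k (x : instr k) q : honest x -> honest (nth (skip i) (at_proc x i) q).
  case: (eqVneq k i) => [<-|ki]; rewrite ?at_proc_same ?at_proc_diff //.
    by case: q => [|q] //= _; rewrite nth_nil.
  by rewrite nth_nil.
elim: P p => [|k x e|k j e|k j x||P IHP Q IHQ] p /=; rewrite ?nth_nil //.
- exact: base.
- by apply: base => s v /=; eexists.
- exact: base.
- by rewrite nth_cat; case: ifP.
Qed.

(** The intermediate cut of a layering is the one at which every process has completed its actions
    of the first part. *)
Lemma instrs_occurs P (r : run Var) (c : 'I_n -> nat) : straight_line P ->
    (forall i p, p < size (acts P i) -> exists v,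
      lrun r i (c i + p).+1 =
        (nth (skip i) (instrs P i) p).2 (lrun r i (c i + p)) v) ->
  occurs P r (fun i => Fin (c i)) (fun i => Fin (c i + size (acts P i))).
Proof.
have adv (b : 'I_n -> nat) k (a : act) : advances (fun i => Fin (b i))
    (fun i => Fin (b i + size (if k == i then [:: a] else [::]))) k (b k).
  split=> //; apply: funext => i; rewrite /upd eq_sym.
  by case: (eqVneq k i) => [<-|_] /=; rewrite ?addn1 ?addn0.
elim: P c => [|k x e|k j e|k j x||P IHP Q IHQ] // c /=.
- move=> _ /(_ k 0); rewrite eqxx at_proc_same /= addn0 => /(_ isT) [v E].
  by exists (c k) => //; apply: adv AInt.
- move=> _ /(_ k 0); rewrite eqxx at_proc_same /= addn0 => /(_ isT) [v E].
  by exists (c k) => //; apply: adv (ASnd j).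
- move=> _ /(_ k 0); rewrite eqxx at_proc_same /= addn0 => /(_ isT) [v E].
  by exists (c k); [apply: adv (ARcv j)|exists v].
move=> /andP [sP sQ] h.
exists (fun i => Fin (c i + size (acts P i))); split.
- by move=> i /=; apply: leq_addr.
- by move=> i /=; rewrite size_cat; lia.
- apply: IHP => // i p hp; have [|v E] := h i p; first by rewrite size_cat; lia.
  by exists v; rewrite E nth_cat -(size_map fst) map_instrs hp.
- have -> : (fun i => Fin (c i + size (acts P i ++ acts Q i))) =
            (fun i => Fin (c i + size (acts P i) + size (acts Q i))).
    by apply: funext => i; rewrite size_cat addnA.
  apply: IHQ => // i p hp.
  have [|v E] := h i (size (acts P i) + p); first by rewrite size_cat; lia.
  exists v; rewrite -addnA E nth_cat -(size_map fst) map_instrs ltnNge leq_addr /=.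
  by rewrite addKn.
Qed.

Section Construction.
(** [dl] takes the position of a receive to that of its send, and [rk] increases along local order
    and messages. Positions count from 0, so position p is the event of index p+1. *)
Variables (R : prog Var) (dl : event -> event) (rk : event -> nat).
Hypothesis slR : straight_line R.
Hypothesis rk_mono : forall i p q, p < q -> rk (i, p) < rk (i, q).
Let act_at (e : event) := nth AInt (acts R e.1) e.2.
Hypothesis dlP : forall e i, act_at e = ARcv i ->
  [/\ (dl e).1 = i, act_at (dl e) = ASnd e.1 & rk (dl e) < rk e].
Hypothesis dl_inj : forall e e' i i', act_at e = ARcv i -> act_at e' = ARcv i' ->
  dl e = dl e' -> e = e'.

Let received (v : event -> int) e : int :=
  if act_at e is ARcv _ then v (dl e) else 0%R.

(** The default [skip] lets a process perform internal events forever after its last action. *)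
Let step_at i p := nth (skip i) (instrs R i) p.

(** [v] is a guess of all values sent, since states depend on values computed by other processes. *)
Fixpoint state v i k : lstate i :=
  if k is p.+1 then (step_at i p).2 (state v i p) (received v (i, p))
  else LState (fun=> 0%R) [::].

Definition sent v (e : event) : int :=
  if last (HRcv e.1 0%R) (hist (state v e.1 e.2.+1)) is HSnd _ w then w else 0%R.

Let agree m (v v' : event -> int) := forall e, rk e < m -> v e = v' e.

(** The state uses [v] only at sends matched with receives before position p, and such sends have
    rank below m. *)
Lemma state_agree m v v' i p : agree m v v' ->
  (forall k, k < p -> rk (i, k) <= m) -> state v i p = state v' i p.
Proof.
move=> vv; elim: p => //= p IH h; rewrite IH => [|k kp]; last by apply: h; lia.
congr (_ _ _); rewrite /received; case E: (act_at _) => [|//|k] //.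
by have [_ _ lt] := dlP E; apply: vv; apply: leq_trans lt (h _ _).
Qed.

Lemma sent_agree m v v' : agree m v v' -> agree m.+1 (sent v) (sent v').
Proof.
move=> vv [i p] h; rewrite /sent (state_agree vv) // => k /= kp.
have := @rk_mono i k p; move: kp; rewrite ltnS leq_eqVlt => /predU1P [->|kp] //.
by move/(_ kp); lia.
Qed.

(* A message is sent at a smaller rank than it is received, so the values sent
   at rank less than N are stable after N rounds. *)
Let vals N := iter N sent (fun=> 0%R).
Let val e := vals (rk e).+1 e.

Lemma vals_stable N M : N <= M -> agree N (vals N) (vals M).
Proof.
elim: N M => [|N IH] [|M] // NM; rewrite /vals /=.
by apply: sent_agree; apply: IH.
Qed.

Lemma val_agree m : agree m val (vals m).
Proof. by move=> e h; apply: vals_stable h _ _. Qed.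

Lemma sent_val e : sent val e = val e.
Proof. by rewrite (sent_agree (@val_agree (rk e))). Qed.

Let pre : prerun (Var := Var) :=
  PreRun (state val) (fun e => let e' := dl (e.1, e.2.-1) in (e'.1, e'.2.+1)).

Lemma pre_honest e : honest (step_at e.1 e.2).
Proof. exact: honest_instr. Qed.

Lemma step_act e : (step_at e.1 e.2).1 = act_at e.
Proof.
rewrite /step_at /act_at -map_instrs; case: (ltnP e.2 (size (instrs R e.1))) => h.
  by rewrite (nth_map (skip _)).
by rewrite !nth_default // size_map.
Qed.

Lemma pre_does i p : does pre (i, p.+1) (act_at (i, p)).
Proof.
have := @pre_honest (i, p) (state val i p) (received val (i, p)).
rewrite step_act; case: (act_at (i, p)) => [|j|j] /= E; first by [].
  by have [w Ew] := E; exists w.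
by exists (received val (i, p)).
Qed.

Lemma pre_rcv e i v : appends pre e (HRcv i v) ->
  act_at (e.1, e.2.-1) = ARcv i /\ v = val (dl (e.1, e.2.-1)).
Proof.
case: e => j [|p] [] //= _ E.
have a : act_at (j, p) = ARcv i.
  by apply: does_inj (pre_does j p) _; exists v; split.
split=> //; move: E; rewrite (_ : hist _ = rcons (hist (state val j p))
    (HRcv i (received val (j, p)))).
  by move/rcons_inj => [<-]; rewrite /received a.
have := @pre_honest (j, p) (state val j p) (received val (j, p)).
by rewrite step_act a.
Qed.

Lemma pre_snd e j : act_at e = ASnd j ->
  appends pre (e.1, e.2.+1) (HSnd j (val e)).
Proof.
case: e => i p a; split=> //=; rewrite -sent_val /sent /=.
have := @pre_honest (i, p) (state val i p) (received val (i, p)).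
by rewrite step_act a /= => -[w ->]; rewrite last_rcons.
Qed.

Lemma pre_lamport e e' : lamport pre e e' -> rk (e.1, e.2.-1) < rk (e'.1, e'.2.-1).
Proof.
elim=> [{}e {}e' [[E h1 h2]|[[i [v /pre_rcv [a _]]] <-]]|x y z _ h _]; last 1 first.
- exact: ltn_trans.
- by rewrite -E; apply: rk_mono; lia.
- have [_ _] := dlP a; rewrite /=.
  by case: (dl _).
Qed.

Lemma pre_is_run : is_run pre.
Proof.
split.
- move=> [i [|p]] // _; have := pre_does i p.
  case: (act_at _) => [|j|j] /= h; [exact: Or33|apply: Or31|apply: Or32];
  by exists j.
- move=> e e' [i [v h]] [i' [v' h']].
  have [a _] := pre_rcv h; have [a' _] := pre_rcv h'; move: h h' => [h _] [h' _].
  move=> /= [E1 E2]; have : (e.1, e.2.-1) = (e'.1, e'.2.-1).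
    apply: dl_inj a a' _; move: E1 E2.
    by case: (dl _) => ? ?; case: (dl _) => ? ? /= -> ->.
  case: e e' h h' {a a' E1 E2} => [j p] [j' p'] /= h h' [-> E]; congr (_, _); lia.
- move=> e i v /pre_rcv [a ->]; have [E as' _] := dlP a.
  by split=> //; have := pre_snd as'; rewrite /=; case: (dl _).
- by move=> e /pre_lamport; rewrite ltnn.
Qed.

Theorem run_exists : exists r : run Var,
  [/\ Rel r, occurs R r (fun=> Fin 0) (fun i => Fin (size (acts R i)))
    & forall j p, delta r (j, p.+1) = ((dl (j, p)).1, (dl (j, p)).2.+1)].
Proof.
exists (Run pre_is_run); split=> //.
(* Each process has finitely many send events, as all events after the end of [R] are internal. *)
- move=> i j k _ _; apply: (sub_finite_set (B := `I_(size (acts R i)).+1)%classic).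
    move=> -[|l] [/= _ [h _]] //; rewrite ltnS; apply: nth_size.
    by rewrite -[nth _ _ _]/(act_at (i, l)) (does_inj (pre_does i l) (h : does _ _ (ASnd j))).
  exact: finite_II.
- by apply: (@instrs_occurs R _ (fun=> 0)) => // i p _; exists (received val (i, p)).
Qed.

End Construction.
End RunConstruction.

(** * Causality in runs of straight-line programs *)

Section Causality.
Context {n : nat} {Var : 'I_n -> eqType}.
Implicit Types (P : prog Var) (r : run Var) (i j : 'I_n) (c d : @cut n).

(* A process at infinity takes part in no occurrence of a program, so the value
   0 chosen for it is irrelevant. *)
Definition start c i : nat := if c i is Fin k then k else 0.

Definition sealed r c : Prop :=
  forall e e', in_cut c e -> matched_with r e e' -> in_cut c e'.

Definition before r := clos_refl_trans (@event n) (causal_step r).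

Lemma before_local r i t t' : 0 < t -> t <= t' -> before r (i, t) (i, t').
Proof.
move=> t0; rewrite leq_eqVlt => /predU1P [->|tt]; first exact: rt_refl.
by apply: rt_step; left.
Qed.

Lemma before_lamport r x y z : before r x y -> lamport r y z -> lamport r x z.
Proof.
move=> /(@clos_rt_rt1n _ _ _ _) xy; elim: xy => // {}x {}y z' st _ IH /IH h.
by apply: t_trans h; apply: t_step.
Qed.

Lemma lamport_before r x y z : lamport r x y -> before r y z -> lamport r x z.
Proof.
move=> h /(@clos_rt_rtn1 _ _ _ _) yz; elim: yz => // u v st _ IH.
by apply: t_trans IH _; apply: t_step.
Qed.

Lemma not_in_cut c i t : 0 < t -> ~ in_cut c (i, t) -> start c i < t.
Proof.
rewrite /in_cut /start /= => t0; case: (c i) => [k|] h; last by case: h.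
by rewrite ltnNge; apply/negP => tk; apply: h.
Qed.

Lemma receive_delta r e i : receives_from r e i ->
  (delta r e).1 = i /\ sends_to r (delta r e) e.1.
Proof.
case: (runP r) => _ _ m _ [v /m [-> h]]; split=> //; by exists v.
Qed.

Lemma receive_matched r e i : receives_from r e i -> matched_with r e (delta r e).
Proof. by move=> h; left; split=> //; exists i. Qed.

Lemma lamport_delta r e i : receives_from r e i -> lamport r (delta r e) e.
Proof. by move=> h; apply: t_step; right; split=> //; exists i. Qed.

Lemma sends_pos r e j : sends_to r e j -> 0 < e.2.
Proof. by case=> v []. Qed.

Section Occurrence.
Variables (P : prog Var) (r : run Var) (c d : @cut n).
Hypothesis occ : occurs P r c d.

Lemma occurs_does i p : p < size (acts P i) ->
  does r (i, (start c i + p).+1) (nth AInt (acts P i) p).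
Proof.
rewrite /start; have := occurs_acts i occ.
by case: (c i) => [k [_ h]|[_ ->]] //; apply: h.
Qed.

Lemma occurs_notin i p : p < size (acts P i) ->
  ~ in_cut c (i, (start c i + p).+1).
Proof.
rewrite /start /in_cut /=; have := occurs_acts i occ.
case: (c i) => [k [_ _] _ [_]|[_ ->]] //=; lia.
Qed.

Lemma occurs_start i : start d i = start c i + size (acts P i).
Proof.
rewrite /start; have := occurs_acts i occ.
by case: (c i) => [k [-> _]|[-> ->]].
Qed.

Lemma occurs_in i p : p < size (acts P i) -> in_cut d (i, (start c i + p).+1).
Proof.
rewrite /start /in_cut /=; have := occurs_acts i occ.
case: (c i) => [k [-> _]|[-> ->]] //=; lia.
Qed.

Lemma occurs_le e : in_cut c e -> in_cut d e.
Proof.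
move=> [h]; have := occurs_acts e.1 occ; rewrite /in_cut.
case: (c _) => [k [-> _]|[-> _]] //=; split=> //; lia.
Qed.

Lemma occurs_cases i t : in_cut d (i, t) ->
  in_cut c (i, t) \/ exists2 p, p < size (acts P i) & t = (start c i + p).+1.
Proof.
rewrite /in_cut /start /=; have := occurs_acts i occ.
case: (c i) => [k [-> _]|[-> _]] [t0 h]; last by left.
case: (leqP t k) => tk; first by left.
by right; exists (t - k.+1); lia.
Qed.

Lemma occurs_receive i j p : p < size (acts P j) ->
  is_rcv i (nth AInt (acts P j) p) -> receives_from r (j, (start c j + p).+1) i.
Proof. by move=> h /is_rcvP a; have := occurs_does h; rewrite a. Qed.

Lemma occurs_send_nth i j p : p < size (acts P i) ->
  sends_to r (i, (start c i + p).+1) j -> is_snd j (nth AInt (acts P i) p).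
Proof.
by move=> h s; rewrite (does_inj (occurs_does h) (s : does r _ (ASnd j))) /=.
Qed.

Hypothesis sc : sealed r c.

(** If the send lay in the sealed cut [c], so would the receive. *)
Lemma delta_notin i j p : p < size (acts P j) ->
    is_rcv i (nth AInt (acts P j) p) ->
  let s := delta r (j, (start c j + p).+1) in
  [/\ s = (i, s.2), start c i < s.2, sends_to r s j & ~ in_cut c s].
Proof.
move=> h a s; have rcv := occurs_receive h a.
have [e1 snd] := receive_delta rcv.
have es : s = (i, s.2) by rewrite -e1 /s; case: (delta _ _).
have ns : ~ in_cut c s.
  move=> cs; apply: (occurs_notin h); apply: sc cs _.
  by right; split=> //; exists i.
split=> //; apply: not_in_cut; first exact: sends_pos snd.
by rewrite -es.
Qed.

Lemma delta_offset_inj i j q q' :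
    q < size (acts P j) -> is_rcv i (nth AInt (acts P j) q) ->
    q' < size (acts P j) -> is_rcv i (nth AInt (acts P j) q') ->
    (delta r (j, (start c j + q).+1)).2 - (start c i).+1 =
    (delta r (j, (start c j + q').+1)).2 - (start c i).+1 -> q = q'.
Proof.
move=> h a h' a' E.
have [e1 l1 _ _] := delta_notin h a; have [e2 l2 _ _] := delta_notin h' a'.
have [_ inj _ _] := runP r.
have r1 : is_receive r (j, (start c j + q).+1) by exists i; apply: occurs_receive.
have r2 : is_receive r (j, (start c j + q').+1) by exists i; apply: occurs_receive.
suff /(inj _ _ r1 r2) [] : delta r (j, (start c j + q).+1)
                          = delta r (j, (start c j + q').+1) by lia.
by rewrite e1 e2; congr (_, _); lia.
Qed.

(* Messages may be reordered, but the first k+1 receives cannot all be matched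
   with the first k sends. *)
Lemma fifo_lamport i j k p q :
    nthp (is_snd j) (acts P i) k p -> nthp (is_rcv i) (acts P j) k q ->
  lamport r (i, (start c i + p).+1) (j, (start c j + q).+1).
Proof.
move=> hp hq; apply: contrapT => nl.
have ps := nthp_size hp; have qs := nthp_size hq.
suff : count (is_rcv i) (take q.+1 (acts P j)) <=
       count (is_snd j) (take p (acts P i)).
  by case: hp hq => [-> _] [_ ->]; lia.
(* [f q'] is the position of the send matched with receive [q']. Without the causal link, [f]
   injects the receives up to [q] into the sends before [p]. *)
pose f q' := (delta r (j, (start c j + q').+1)).2 - (start c i).+1.
rewrite -[X in X <= _]add0n; apply: (@count_take_inj _ AInt _ _ _ _ _ _ f [::]) => //.
  move=> q' q'q a; have q's : q' < size (acts P j) by lia.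
  have [es ls ss _] := delta_notin q's a.
  (* A matched send at or after [p] would give a chain from send [p] through it and receive [q'] to
     receive [q]. *)
  have sp : (delta r (j, (start c j + q').+1)).2 <= start c i + p.
    rewrite leqNgt; apply/negP => sp; apply: nl.
    apply: (@before_lamport _ _ (delta r (j, (start c j + q').+1))).
      by rewrite es; apply: before_local.
    apply: lamport_before (lamport_delta (occurs_receive q's a)) _.
    by apply: before_local => //; lia.
  have fE : (start c i + f q').+1 = (delta r (j, (start c j + q').+1)).2.
    by rewrite /f; lia.
  split=> //; first by rewrite /f; lia.
  apply: occurs_send_nth; first by rewrite /f; lia.
  by rewrite fE -es.
by move=> q1 q2 h1 a1 h2 a2; apply: delta_offset_inj a1 _ a2; lia.
Qed.

(** If a send of [P] were received outside [d], the receives of [P] would inject into the remaining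
    sends of [P], against the equal counts. *)
Lemma sealed_after :
    (forall i j, count (is_snd j) (acts P i) = count (is_rcv i) (acts P j)) ->
    (forall i j p, p < size (acts P j) -> is_rcv i (nth AInt (acts P j) p) ->
      in_cut d (delta r (j, (start c j + p).+1))) ->
  sealed r d.
Proof.
move=> bal rcv [i t] e' /occurs_cases [ce|[p ps ->]] m.
  by apply: occurs_le; apply: sc ce m.
case: m => [] [[k a] E].
  rewrite -E; apply: (rcv k) => //.
  by rewrite (does_inj (occurs_does ps) (a : does r _ (ARcv k))) /=.
have [ek snd] := receive_delta a; move: ek snd; rewrite E => /= ek; subst k.
move=> snd; case: e' a E snd => j u /= a E snd; apply: contrapT => nu.
have : (count (is_rcv i) (acts P j)).+1 <= count (is_snd j) (acts P i).
  pose f q := (delta r (j, (start c j + q).+1)).2 - (start c i).+1.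
  rewrite -[in X in X <= _](take_size (acts P j)) -[in X in _ <= X](take_size (acts P i)).
  apply: (@count_take_inj _ AInt _ _ _ _ _ _ f [:: p]) => //.
  - by move=> x; rewrite inE => /eqP ->; split=> //; apply: occurs_send_nth.
  - move=> q qs b; have [es ls ss ns] := delta_notin qs b.
    have fE : (start c i + f q).+1 = (delta r (j, (start c j + q).+1)).2.
      by rewrite /f; lia.
    have fs : f q < size (acts P i).
      have := rcv _ _ _ qs b; rewrite es => /occurs_cases [|[x xs E']].
        by rewrite -es.
      by rewrite /f E'; lia.
    split=> //; first by apply: occurs_send_nth => //; rewrite fE -es.
    rewrite inE; apply/eqP => fp; apply: nu.
    have [_ inj _ _] := runP r.
    rewrite (inj (j, u) (j, (start c j + q).+1)); first exact: occurs_in.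
    - by exists i.
    - by exists i; apply: occurs_receive.
    - by rewrite E es -fE fp.
  - by move=> q1 q2 h1 a1 h2 a2; apply: delta_offset_inj.
by rewrite bal ltnn.
Qed.

End Occurrence.
End Causality.

(** * Program graphs and causality along their paths *)

Section Graph.
Context {n : nat} {Var : 'I_n -> eqType}.
Implicit Types (P : prog Var) (i j : 'I_n) (u v w : @node n).
Notation path P := (clos_trans (@node n) (edge P)).

Lemma nth_sndP P i j k q :
  nth_snd P i j k q <-> nthp (is_snd j) (comms P i) k q.
Proof.
rewrite /nth_snd (onth_SomeP AInt) (nthpP AInt); split=> [[[h ->] e]|[h /is_sndP e1 e]] //.
by rewrite /= eqxx.
Qed.

Lemma nth_rcvP P i j k q :
  nth_rcv P i j k q <-> nthp (is_rcv j) (comms P i) k q.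
Proof.
rewrite /nth_rcv (onth_SomeP AInt) (nthpP AInt); split=> [[[h ->] e]|[h /is_rcvP e1 e]] //.
by rewrite /= eqxx.
Qed.

Lemma comm_pos P i q : q < size (comms P i) ->
  exists p, nthp (@is_comm n) (acts P i) q p.
Proof. by rewrite size_filter => /nthp_ex. Qed.

Lemma nth_snd_acts P i j k q p : nthp (@is_comm n) (acts P i) q p ->
  nth_snd P i j k q <-> nthp (is_snd j) (acts P i) k p.
Proof. by move=> h; rewrite nth_sndP; apply: nthp_filter (@snd_comm _ j) h. Qed.

Lemma nth_rcv_acts P i j k q p : nthp (@is_comm n) (acts P i) q p ->
  nth_rcv P i j k q <-> nthp (is_rcv j) (acts P i) k p.
Proof. by move=> h; rewrite nth_rcvP; apply: nthp_filter (@rcv_comm _ j) h. Qed.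

Lemma nth_snd_size P i j k q : nth_snd P i j k q -> q < size (comms P i).
Proof. by move/nth_sndP/nthp_size. Qed.

Lemma nth_rcv_size P i j k q : nth_rcv P i j k q -> q < size (comms P i).
Proof. by move/nth_rcvP/nthp_size. Qed.

(** Together with [path_target], this excludes dummy nodes from the interior of paths. *)
Lemma path_source P u v : path P u v ->
  match u with
  | NFst _ => True | NLst _ => False | NEv i q => q < size (comms P i)
  end.
Proof.
elim=> {u v} // u v; case=> // [i p /ltnW|i p <-|i j k p q /nth_snd_size] //.
Qed.

Lemma path_target P u v : path P u v ->
  match v with
  | NFst _ => False | NLst _ => True | NEv i q => q < size (comms P i)
  end.
Proof.
by elim=> {u v} // u v; case=> // i j k p q _ /nth_rcv_size.
Qed.

Lemma path_local P i q q' : q < q' -> q' < size (comms P i) ->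
  path P (NEv i q) (NEv i q').
Proof.
elim: q' => // q' IH; rewrite ltnS leq_eqVlt => /predU1P [->|qq] qs.
  by apply: t_step; apply: edge_succ.
by apply: t_trans (IH qq (ltnW qs)) _; apply: t_step; apply: edge_succ.
Qed.

Lemma path_local_le P u i q q' : path P u (NEv i q) -> q <= q' ->
  q' < size (comms P i) -> path P u (NEv i q').
Proof.
move=> h; rewrite leq_eqVlt => /predU1P [<- //|qq] qs.
by apply: t_trans h _; apply: path_local.
Qed.

Lemma path_lst P i q : q < size (comms P i) -> path P (NEv i q) (NLst i).
Proof.
move=> qs; have last : path P (NEv i (size (comms P i)).-1) (NLst i).
  by apply: t_step; apply: edge_lst; lia.
case: (leqP (size (comms P i)).-1 q) => h.
  by rewrite (_ : q = (size (comms P i)).-1) //; lia.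
by apply: t_trans last; apply: path_local => //; lia.
Qed.

Lemma path_fst P i q : q < size (comms P i) -> path P (NFst i) (NEv i q).
Proof.
move=> qs; have first : path P (NFst i) (NEv i 0).
  by apply: t_step; apply: edge_fst; lia.
by apply: path_local_le first _ qs.
Qed.

Section PathLamport.
(** Offsets and message order are abstract because the cut at which Q starts is not known to be
    sealed: there the order comes from P followed by Q. *)
Variables (r : run Var) (P : prog Var) (o : 'I_n -> nat).
Hypothesis fifo : forall i j k p q,
  nthp (is_snd j) (acts P i) k p -> nthp (is_rcv i) (acts P j) k q ->
  lamport r (i, (o i + p).+1) (j, (o j + q).+1).

(** A first node stands for the first event after the offset; no path starts at a last node. *)
Definition up_to u (x : @event n) : Prop :=
  match u with
  | NFst k => x.1 = k /\ 0 < x.2 <= (o k).+1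
  | NEv k q => x.1 = k /\ exists2 p, nthp (@is_comm n) (acts P k) q p &
      0 < x.2 <= (o k + p).+1
  | NLst _ => False
  end.

(** A last node stands for the events after all actions of [P]; no path ends at a first node. *)
Definition from v (y : @event n) : Prop :=
  match v with
  | NFst _ => False
  | NEv k q => y.1 = k /\ exists2 p, nthp (@is_comm n) (acts P k) q p &
      (o k + p).+1 <= y.2
  | NLst k => y.1 = k /\ o k + size (acts P k) < y.2
  end.

(** An edge is a piece of local order or a message. A path splits at an inner node, which is a
    communication and so an actual event. *)
Lemma path_before u v x y : path P u v -> up_to u x -> from v y -> before r x y.
Proof.
have loc z z' : z.1 = z'.1 -> 0 < z.2 -> z.2 <= z'.2 -> before r z z'.
  by case: z z' => [i t] [i' t'] /= <-; apply: before_local.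
move=> h; elim: h x y => {u v} [u v e|u w v h1 IH1 h2 IH2] x y.
  case: e => [i sz|i sz|i p sp|i p sp|i j k p q].
  - by move=> [x1 hx] [y1 [p hp hy]]; apply: loc; rewrite ?x1 ?y1 //; lia.
  - by move=> [x1 hx] [y1 hy]; apply: loc; rewrite ?x1 ?y1 //; lia.
  - move=> [x1 [a ha hx]] [y1 [b hb hy]].
    have := nthp_lt ha hb; rewrite ltnSn => /esym ab.
    by apply: loc; rewrite ?x1 ?y1 //; lia.
  - move=> [x1 [a /nthp_size ha hx]] [y1 hy].
    by apply: loc; rewrite ?x1 ?y1 //; lia.
  - move=> hs hr [x1 [a ha hx]] [y1 [b hb hy]].
    move/(nth_snd_acts _ _ ha) in hs; move/(nth_rcv_acts _ _ hb) in hr.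
    apply: rt_trans (loc x (i, (o i + a).+1) _ _ _) _ => //=; try lia.
    apply: rt_trans (loc (j, (o j + b).+1) y _ _ _) => //=.
    by apply: clos_t_clos_rt; apply: fifo hs hr.
move=> hx hy; have := path_target h1; have := path_source h2.
case: w h1 IH1 h2 IH2 => // k q h1 IH1 h2 IH2 qs _.
have [p hp] := comm_pos qs.
apply: rt_trans (IH1 _ (k, (o k + p).+1) hx _) (IH2 _ _ _ hy).
  by split=> //; exists p.
by split=> //; exists p => //=; rewrite leqnn.
Qed.

End PathLamport.

End Graph.

(** * Runs with a prescribed matching, and balance as equality of counts *)

Section Balance.
Context {n : nat} {Var : 'I_n -> eqType}.
Implicit Types (P R : prog Var) (i j : 'I_n).

(** [sg i j k] is the number of the send matched with the k-th receive; the last hypothesis makes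
    messages increase the rank. *)
Lemma matching_run R (sg : 'I_n -> 'I_n -> nat -> nat) (rk : 'I_n -> nat -> nat) :
    straight_line R ->
    (forall i p q, p < q -> rk i p < rk i q) ->
    (forall i j k, k < count (is_rcv i) (acts R j) ->
       sg i j k < count (is_snd j) (acts R i)) ->
    (forall i j, injective (sg i j)) ->
    (forall i j k p q, nthp (is_snd j) (acts R i) (sg i j k) p ->
       nthp (is_rcv i) (acts R j) k q -> rk i p < rk j q) ->
  exists r : run Var,
    [/\ Rel r, occurs R r (fun=> Fin 0) (fun i => Fin (size (acts R i)))
      & forall i j k p q, nthp (is_snd j) (acts R i) (sg i j k) p ->
          nthp (is_rcv i) (acts R j) k q -> delta r (j, q.+1) = (i, p.+1)].
Proof.
move=> sl mono sgC sgI ord.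
pose rn i (e : @event n) := count (is_rcv i) (take e.2 (acts R e.1)).
have ex (e : @event n) : exists e' : @event n, forall i,
    nth AInt (acts R e.1) e.2 = ARcv i ->
    e'.1 = i /\ nthp (is_snd e.1) (acts R i) (sg i e.1 (rn i e)) e'.2.
  case a: (nth AInt (acts R e.1) e.2) => [|j|i]; [by exists e|by exists e|].
  have [p hp] := nthp_ex (sgC _ _ _ (nthp_count (rcv_nthp a))).
  by exists (i, p) => k [<-].
have [dl dlP] := choice ex.
have [||r [rel occ dE]] := @run_exists n Var R dl (fun e => rk e.1 e.2) sl mono.
- move=> e i a; have [d1 d2] := dlP _ _ a; split=> //.
    by rewrite d1 (nthp_snd d2).
  by rewrite d1; apply: ord d2 (rcv_nthp a).
- move=> e e' i i' a a' E; have [d1 d2] := dlP _ _ a; have [d1' d2'] := dlP _ _ a'.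
  have ii : i' = i by rewrite -d1 -d1' E.
  rewrite {}ii in a' d2' {d1'}; have [e1] : ASnd e.1 = ASnd e'.1 :> @act n.
    by rewrite -(nthp_snd d2) -(nthp_snd d2') E.
  have := rcv_nthp a; have := rcv_nthp a'.
  have : rn i e = rn i e'.
    by apply: (sgI i e.1); case: d2 d2' => [<- _]; rewrite -e1 E => -[<- _].
  rewrite /rn => -> h' h; move: h; rewrite e1 => /nthp_uniq /(_ h').
  by case: (e) (e') e1 => [? ?] [? ?] /= -> ->.
exists r; split=> // i j k p q hp hq; rewrite dE.
have [d1 d2] := dlP (j, q) _ (nthp_rcv hq); rewrite d1; congr (_, _.+1).
by apply: nthp_uniq d2 _; rewrite /rn /=; case: hq => ->.
Qed.

Lemma empty_chan (r : run Var) i j : chan r (fun=> Fin 0) i j = set0.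
Proof. by apply/seteqP; split=> -[k t] //= [] [[/= t0]]; lia. Qed.

(** [P] can run to completion, so receives do not outnumber sends. In the run with FIFO matching all
    receives are matched, so a surplus send would violate balance. *)
Lemma bsl_count P i j : BSL P -> deadlock_free P ->
  count (is_snd j) (acts P i) = count (is_rcv i) (acts P j).
Proof.
move=> [sl bal] /deadlock_free_completes [m st].
have le i' j' : count (is_rcv i') (acts P j') <= count (is_snd j') (acts P i').
  by have := steps_count i' j' st; rewrite /=; lia.
have [rk [mono fifo]] : schedulable (acts P, fun=> 0).
  have <- : (fun i => acts P i ++ [::]) = acts P.
    by apply: funext => k; rewrite cats0.
  apply: (steps_schedulable (u := fun=> [::]) st) => /=.
  by exists (fun _ p => p); split=> // ? ? ? ? ? [].
have [|||r [rel occ dE]] := @matching_run P (fun _ _ => id) rk sl mono _ _ _.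
- by move=> i' j' k h; apply: leq_trans h (le _ _).
- by move=> ? ? ? ?.
- by move=> i' j' k p q h h'; apply: fifo h h'.
apply/eqP; rewrite eqn_leq le andbT leqNgt; apply/negP => lt.
(* Numbers start at 0, so the send numbered by the count of receives is the first surplus one. *)
have [p hp] := nthp_ex lt; have ps := nthp_size hp.
have := bal r _ _ rel occ (empty_chan r) i j.
have -> : chan_receives r (fun i => Fin (size (acts P i))) i j = set0.
  rewrite -subset0 => -[j' [|q]] [[/= // _ qs]] jj rq []; subst j'.
  have dq : does r (j, q.+1) (nth AInt (acts P j) q) := occurs_does occ qs.
  have hq := rcv_nthp (does_inj dq (rq : does r _ (ARcv i))).
  have [s hs] := nthp_ex (leq_trans (nthp_count hq) (le _ _)).
  exists (i, s.+1); split; last by split=> //; apply: nthp_size hs.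
  by left; split; [exists i|apply: dE hs hq].
rewrite card_eq0 => /eqP/seteqP [/(_ (i, p.+1)) + _]; apply; split=> //.
  by have := occurs_does occ ps; rewrite (nthp_snd hp).
move=> [[j' [|q]] [[[[k rk'] E]|[[k rq] E]] [/= // _ qs]]].
  have dp : does r (i, p.+1) (nth AInt (acts P i) p) := occurs_does occ ps.
  by have := does_inj dp (rk' : does r _ (ARcv k)); rewrite (nthp_snd hp).
have dq : does r (j', q.+1) (nth AInt (acts P j') q) := occurs_does occ qs.
have hq := rcv_nthp (does_inj dq (rq : does r _ (ARcv k))).
have [s hs] := nthp_ex (leq_trans (nthp_count hq) (le _ _)).
move: E; rewrite (dE _ _ _ _ _ hs hq) => -[ki sp]; subst k s.
move: (nthp_snd hs); rewrite (nthp_snd hp) => -[jj]; subst j'.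
by move: (nthp_count hq); case: hs => <- _; case: hp => -> _; rewrite ltnn.
Qed.

End Balance.

(** * The two implications *)

Section Sufficiency.
Context {n : nat} {Var : 'I_n -> eqType}.
Implicit Types (P Q : prog Var) (i j : 'I_n).
Notation path P := (clos_trans (@node n) (edge P)).

Lemma denotes_rcvP P j i u : denotes P (GRcv j i) u <->
  exists q k, [/\ u = NEv j q, count (is_rcv i) (acts P j) = k.+1
                & nth_rcv P j i k q].
Proof.
have cE : count (is_rcv i) (acts P j) = count (is_rcv i) (comms P j).
  by rewrite count_filter; apply: eq_count => -[] //= k; rewrite andbT.
split=> [[q -> [on hn]]|[q [k [-> ck hk]]]].
  have hq : nth_rcv P j i (count (is_rcv i) (take q (comms P j))) q by [].
  exists q, (count (is_rcv i) (take q (comms P j))); split=> //.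
  have [_ <-] := (nth_rcvP P j i _ q).1 hq; rewrite cE.
  rewrite -{1}(cat_take_drop q.+1 (comms P j)) count_cat.
  by move: hn; rewrite has_count -eqn0Ngt => /eqP ->; rewrite addn0.
exists q => //; split; first by case: hk.
have [_] := (nth_rcvP P j i k q).1 hk; rewrite has_count -eqn0Ngt -ck cE.
by rewrite -{2}(cat_take_drop q.+1 (comms P j)) count_cat; lia.
Qed.

Lemma denotes_rcv_ex P j i : 0 < count (is_rcv i) (acts P j) ->
  exists u, denotes P (GRcv j i) u.
Proof.
case ck : (count _ _) => [//|k] _.
have [p hp] : exists p, nthp (is_rcv i) (acts P j) k p by apply: nthp_ex; rewrite ck.
have hq := nthp_sub (@rcv_comm _ i) hp.
exists (NEv j (count (@is_comm n) (take p (acts P j)))).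
apply/denotes_rcvP; do 2!eexists; split; [by []|exact: ck|].
by apply/(nth_rcv_acts _ _ hq).
Qed.

Lemma denotes_snd_ex P i j : 0 < count (is_snd j) (acts P i) ->
  exists u, denotes P (GSnd i j) u.
Proof.
move=> /nthp_ex [p hp]; have hq := nthp_sub (@snd_comm _ j) hp.
by do 2!eexists; [|apply/(nth_snd_acts _ _ hq)].
Qed.

Lemma conditions_seal P Q :
    (forall i j, count (is_snd j) (acts P i) = count (is_rcv i) (acts P j)) ->
    (forall i j, sigV P (GRcv j i) -> exists k,
      [/\ sigE P (GRcv j i, GLst k), sigE Q (GFst k, GLst i)
        & sigV Q (GSnd i j) -> sigE Q (GFst k, GSnd i j)]) ->
  seals Rel Q P.
Proof.
move=> bal cond r _ c d [c2 [le1 le2 [c1 [_ le3 [ec sc] occP]] occQ]]; subst c1.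
rewrite -/(sealed r c) in sc.
suff sc2 : sealed r c2.
  exists c2; split=> //; exists c2; split=> //.
  by move=> i; case: (c2 i) => /=.
apply: (sealed_after occP sc bal) => i j p ps a; apply: contrapT => ns.
set e := (j, (start c j + p).+1); set s := delta r e in ns.
have rcv := occurs_receive occP ps a; rewrite -/e in rcv.
have [es _ snd _] := delta_notin occP sc ps a; rewrite -/e -/s in es snd.
have ls : start c2 i < s.2.
  by apply: not_in_cut; [exact: sends_pos snd|rewrite -es].
(* The send [s] precedes its receive [e], so a chain from [e] to [s] closes a causal cycle. *)
suff es' : before r e s.
  by have [_ _ _ /(_ e)] := runP r; apply; apply: before_lamport es' (lamport_delta rcv).
have st2 := occurs_start occP; have st3 := occurs_start occQ.
have pathP u v x y := @path_before _ _ r P (start c)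
  (@fifo_lamport _ _ _ _ _ _ occP sc) u v x y.
have occPQ : occurs (Layer P Q) r c d by exists c2.
(* The message order in [Q] is that of [P] followed by [Q]; balance of [P] shifts the numbers of
   sends and receives equally. *)
have pathQ u v x y : path Q u v -> up_to Q (start c2) u x ->
    from Q (start c2) v y -> before r x y.
  apply: path_before => i' j' k p' q' hp hq; rewrite !st2 -!addnA.
  by apply: (fifo_lamport occPQ sc (nthp_catr _ hp)); rewrite bal; apply: nthp_catr.
have cnt : 0 < count (is_rcv i) (acts P j).
  by apply: leq_ltn_trans (nthp_count (rcv_nthp (is_rcvP a))).
have up_e v : denotes P (GRcv j i) v -> up_to P (start c) v e.
  move=> /denotes_rcvP [q [k [-> ck hk]]]; split=> //.
  have [p0 hp0] := comm_pos (nth_rcv_size hk); exists p0 => //=.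
  have hr := (nth_rcv_acts _ _ hp0).1 hk.
  have hp := rcv_nthp (is_rcvP a).
  have := nthp_count hp; rewrite ck ltnS => ?.
  suff : p <= p0 by rewrite !ltnS leq_add2l.
  by rewrite leqNgt -(nthp_lt hr hp) -leqNgt.
(* If the receive is removed from the signature, a path of [P] leads from it to the last node of
   [i], after which [s] occurs. *)
case: (pselect (E0plus P (GRcv j i) (GLst i))) => [[u [_ [hu -> h]]]|nE].
  by apply: pathP h (up_e _ hu) _; rewrite es /= -st2.
have [k [[_ _ [u [_ [hu -> h1]]]] [_ _ [_ [_ [-> -> h2]]]] h3]] :
  exists k, [/\ sigE P (GRcv j i, GLst k), sigE Q (GFst k, GLst i)
        & sigV Q (GSnd i j) -> sigE Q (GFst k, GSnd i j)].
  by apply: cond; split=> //; apply: denotes_rcv_ex.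
have ek : before r e (k, (start c2 k).+1).
  by apply: pathP h1 (up_e _ hu) _; rewrite /= -st2.
have upk : up_to Q (start c2) (NFst k) (k, (start c2 k).+1) by split=> /=.
(* A send after [Q] is reached through (b); one within [Q] through (c) or, if removed from the
   signature, from the first node of [j]. *)
case: (pselect (in_cut d s)) => sd; last first.
  apply: rt_trans ek (pathQ _ _ _ _ h2 upk _); rewrite es /= -st3; split=> //.
  by apply: not_in_cut; [exact: sends_pos snd|rewrite -es].
have [p1 p1s sE] : exists2 p1, p1 < size (acts Q i) & s.2 = (start c2 i + p1).+1.
  by move: sd; rewrite es => /(occurs_cases occQ) [|//]; rewrite -es.
have a1 : is_snd j (nth AInt (acts Q i) p1).
  by apply: (occurs_send_nth occQ p1s); rewrite -sE -es.
have from_s v : denotes Q (GSnd i j) v -> from Q (start c2) v s.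
  move=> [q -> hq]; rewrite es; split=> //.
  have [p0 hp0] := comm_pos (nth_snd_size hq); exists p0 => //=.
  have hr := (nth_snd_acts _ _ hp0).1 hq.
  rewrite sE ltnS leq_add2l leqNgt.
  by rewrite -(nthp_lt (snd_nthp (is_sndP a1)) hr).
case: (pselect (E0plus Q (GFst j) (GSnd i j))) => [[_ [v [-> hv h]]]|nE'].
  apply: pathQ h _ (from_s _ hv); split=> //=.
  by rewrite st2; lia.
have [_ _ [_ [v [-> hv h]]]] : sigE Q (GFst k, GSnd i j).
  apply: h3; split=> //; apply: denotes_snd_ex.
  by apply: leq_ltn_trans (nthp_count (snd_nthp (is_sndP a1))).
exact: rt_trans ek (pathQ _ _ _ _ h upk (from_s _ hv)).
Qed.

(** Yields the finiteness part of proper sealing: each process advances by the finite number of its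
    actions. *)
Lemma occurs_finite P (r : run Var) (c d : @cut n) :
  occurs P r c d -> finite_cut c -> finite_cut d.
Proof.
by move=> occ fc i; have := occurs_acts i occ; case: (c i) (fc i) => // k _ [->].
Qed.

End Sufficiency.

(** * Sealing implies the conditions *)

Section Necessity.
Context {n : nat} {Var : 'I_n -> eqType}.
Implicit Types (P Q R : prog Var) (i j : 'I_n).
Notation path P := (clos_trans (@node n) (edge P)).

(* Matching receive number kr with the later send number T is causally
   consistent as long as some set U of positions, closed under causality,
   contains the receive but not the send: delaying U past the send turns a
   schedule into one for the new matching. *)
Lemma swapped_run R i j kr T pr pT (rk : 'I_n -> nat -> nat)
    (U : 'I_n -> nat -> Prop) :
    straight_line R -> schedule (acts R, fun=> 0) rk ->
    (forall i' j', count (is_rcv i') (acts R j') <= count (is_snd j') (acts R i')) ->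
    kr < T ->
    nthp (is_snd j) (acts R i) T pT -> nthp (is_rcv i) (acts R j) kr pr ->
    (forall k p q, p <= q -> U k p -> U k q) ->
    (forall i' j' k p q, nthp (is_snd j') (acts R i') k p ->
       nthp (is_rcv i') (acts R j') k q -> U i' p -> U j' q) ->
    U j pr -> ~ U i pT ->
  exists r : run Var,
    [/\ Rel r, occurs R r (fun=> Fin 0) (fun i => Fin (size (acts R i)))
      & delta r (j, pr.+1) = (i, pT.+1)].
Proof.
move=> sl [mono fifo] le krT hT hr Umono Umsg Ur UT.
(* On the channel from [i] to [j] the sends [kr] and [T] trade places, which keeps [sg]
   injective. *)
pose sg i' j' k := if (i' == i) && (j' == j) then
    (if k == kr then T else if k == T then kr else k) else k.
(* The increment exceeds the rank of send [T], so all of [U] is ranked after it. *)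
pose rk' k p := rk k p + (if `[< U k p >] then (rk i pT).+1 else 0).
have [||||r [rel occ dE]] := @matching_run n Var R sg rk' sl _ _ _ _.
- move=> k p q pq; rewrite /rk'; have := mono k p q pq.
  case: asboolP => [up|_]; last by lia.
  by rewrite asboolT; [lia|apply: Umono up; apply: ltnW].
- move=> i' j' k hk; rewrite /sg; case: andP => [[/eqP ei /eqP ej]|_].
    subst i' j'; case: eqP => _; first exact: nthp_count hT.
    case: eqP => _; last exact: leq_trans hk (le _ _).
    exact: ltn_trans krT (nthp_count hT).
  exact: leq_trans hk (le _ _).
- move=> i' j' k k'; rewrite /sg; case: andP => // _.
  by do 4?[case: eqP]; lia.
- move=> i' j' k p q; rewrite /sg.
  have main : nthp (is_snd j') (acts R i') k p ->
      nthp (is_rcv i') (acts R j') k q -> rk' i' p < rk' j' q.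
    move=> hp hq; rewrite /rk'; have := fifo i' j' k p q hp hq.
    case: asboolP => [up|_]; last by lia.
    by rewrite asboolT; [lia|apply: Umsg hp hq up].
  case: andP => [[/eqP ei /eqP ej]|_] //; subst i' j'.
  case: eqP => [->|_].
    move=> /(nthp_uniq hT) <- /(nthp_uniq hr) <-; rewrite /rk' asboolF // asboolT //.
    by lia.
  (* Receive [T], now matched with send [kr], comes after receive [kr] and hence lies in [U]. *)
  case: eqP => [->|_] // hp hq.
  have /ltnW prq : pr < q by rewrite -(nthp_lt hr hq).
  have := fifo i j kr p pr hp hr.
  have : rk j pr < rk j q by apply: mono; rewrite -(nthp_lt hr hq).
  rewrite /rk' (asboolT (Umono _ _ _ prq Ur)); case: asboolP => _; lia.
exists r; split=> //; apply: dE hr.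
by rewrite /sg !eqxx.
Qed.

(** By balance, complete executions of [P] and [Q] leave all channels empty, so they can be
    concatenated; [x] has no receives and any local order schedules it. *)
Lemma layer_schedulable P Q (x : 'I_n -> seq act) :
    (forall i j, count (is_snd j) (acts P i) = count (is_rcv i) (acts P j)) ->
    (forall i j, count (is_snd j) (acts Q i) = count (is_rcv i) (acts Q j)) ->
    deadlock_free P -> deadlock_free Q -> (forall i j, count (is_rcv i) (x j) = 0) ->
  schedulable (fun i => acts P i ++ (acts Q i ++ x i), fun=> 0).
Proof.
move=> balP balQ dfP dfQ x0.
have frame R u : (forall i j, count (is_snd j) (acts R i) = count (is_rcv i) (acts R j)) ->
    deadlock_free R -> schedulable (u, fun=> 0) ->
    schedulable (fun i => acts R i ++ u i, fun=> 0).
  move=> bal /deadlock_free_completes [m st] su.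
  apply: (steps_schedulable (u := u) st) => /=; suff -> : m = (fun=> 0) by [].
  apply: funext => -[i j]; have := steps_count i j st; rewrite /= bal; lia.
apply: (frame P) => //; apply: (frame Q) => //.
exists (fun _ p => p); split=> // i j k p q _ /nthp_count /=.
by rewrite x0.
Qed.

(** * Positions reachable from a node of P *)

Section Reach.
Variables (P Q : prog Var) (x : 'I_n -> seq (@act n)).
Hypothesis balP :
  forall i j, count (is_snd j) (acts P i) = count (is_rcv i) (acts P j).
Hypothesis balQ :
  forall i j, count (is_snd j) (acts Q i) = count (is_rcv i) (acts Q j).
Hypothesis x0 : forall i j, count (is_rcv i) (x j) = 0.
Variable u0 : @node n.

Definition reach v := v = u0 \/ path P u0 v.

(** Translates positions into numbers of communications: [q < ncomm P k p.+1] says that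
    communication q lies at or before position p. *)
Definition ncomm P k p := count (@is_comm n) (take p (acts P k)).

(* The positions of P followed by Q that are reachable from the node u0 of P. *)
Definition reached k p : Prop :=
  (exists2 q, q < ncomm P k p.+1 & reach (NEv k q)) \/
  (exists q k', [/\ reach (NLst k'), path Q (NFst k') (NEv k q)
     & q < ncomm Q k (p.+1 - size (acts P k))]).

Lemma reach_path v w : reach v -> path P v w -> reach w.
Proof. by move=> [->|h] h'; right=> //; apply: t_trans h h'. Qed.

Lemma reach_local k q q' : reach (NEv k q) -> q <= q' ->
  q' < size (comms P k) -> reach (NEv k q').
Proof.
move=> h; rewrite leq_eqVlt => /predU1P [<- //|qq] qs.
exact: reach_path h (path_local qq qs).
Qed.

Lemma ncomm_size R k p : ncomm R k p <= size (comms R k).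
Proof.
by rewrite size_filter -[X in _ <= count _ X](cat_take_drop p) count_cat leq_addr.
Qed.

Lemma ncomm_edge R i j k p q :
    nthp (is_snd j) (acts R i) k p -> nthp (is_rcv i) (acts R j) k q ->
  edge R (NEv i (ncomm R i p)) (NEv j (ncomm R j q)).
Proof.
move=> hp hq; apply: edge_msg.
  by apply/(nth_snd_acts _ _ (nthp_sub (@snd_comm _ j) hp)); exact: hp.
by apply/(nth_rcv_acts _ _ (nthp_sub (@rcv_comm _ i) hq)).
Qed.

Lemma reached_mono k p q : p <= q -> reached k p -> reached k q.
Proof.
move=> pq [[a h r]|[a [k' [h1 h2 h3]]]]; [left; exists a|right; exists a, k'] => //.
  by apply: leq_trans h _; apply: count_take_le.
split=> //; apply: leq_trans h3 _; apply: count_take_le; lia.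
Qed.

Lemma reached_lst k p :
  (exists2 q, q < ncomm P k p & reach (NEv k q)) -> reach (NLst k).
Proof.
move=> [q h r]; apply: reach_path r _; apply: path_lst.
exact: leq_trans h (ncomm_size _ _ _).
Qed.

(** Balance keeps messages of [P] within [P] and those of [Q] within [Q]. From [P], positions of [Q]
    are reached through a last node of [P] and the first node of the same process in [Q]. *)
Lemma reached_msg i j k p q :
    nthp (is_snd j) (acts P i ++ (acts Q i ++ x i)) k p ->
    nthp (is_rcv i) (acts P j ++ (acts Q j ++ x j)) k q ->
  reached i p -> reached j q.
Proof.
have nS R i' a k' p' : subpred a (@is_comm n) -> nthp a (acts R i') k' p' ->
    ncomm R i' p'.+1 = (ncomm R i' p').+1 /\ ncomm R i' p' < size (comms R i').
  move=> sub /(nthp_sub sub) h; split; first by case: h.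
  by rewrite size_filter; apply: nthp_count h.
case/nthp_cat=> [hp|[k1 [p1 [-> -> hp]]]] /nthp_cat [hq|[k2 [q1 [k2E -> hq]]]].
- have [eP sP] := nS _ _ _ _ _ (@snd_comm _ j) hp.
  have [eQ sQ] := nS _ _ _ _ _ (@rcv_comm _ i) hq.
  move=> [[a]|[a [k' [_ _]]]]; last first.
    by rewrite (eqP (nthp_size hp : p.+1 - size (acts P i) == 0)) /ncomm take0.
  rewrite eP ltnS => ap ra; left; exists (ncomm P j q); first by rewrite eQ.
  apply: reach_path (reach_local ra ap sP) _; apply: t_step.
  exact: ncomm_edge hp hq.
- by move: (nthp_count hp); rewrite balP; lia.
- by move: (nthp_count hq); rewrite balP; lia.
have ke : k2 = k1 by rewrite balP in k2E; lia.
subst k2; clear k2E.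
move: hq => /nthp_cat [hq|[k2 [q2 [_ _ /nthp_count]]]]; last by rewrite x0.
move: hp => /nthp_cat [hp|[k3 [p3 [k3E _ _]]]]; last first.
  by move: (nthp_count hq); rewrite -balQ; lia.
have [eP sP] := nS _ _ _ _ _ (@snd_comm _ j) hp.
have [eQ sQ] := nS _ _ _ _ _ (@rcv_comm _ i) hq.
move=> ri; suff [k' rk' pk'] : exists2 k', reach (NLst k')
    & path Q (NFst k') (NEv i (ncomm Q i p1)).
  right; exists (ncomm Q j q1), k'; split=> //.
    by apply: t_trans pk' _; apply: t_step; apply: ncomm_edge hp hq.
  by rewrite -addnS addKn eQ.
case: ri => [/reached_lst h|[a [k' [h1 h2]]]]; first by exists i => //; apply: path_fst.
rewrite -addnS addKn eP ltnS => ap; exists k' => //.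
exact: path_local_le h2 ap sP.
Qed.

End Reach.

Lemma seal_conditions P Q :
    BSL P -> BSL Q -> deadlock_free P -> deadlock_free Q -> seals Rel Q P ->
  forall i j, sigV P (GRcv j i) -> exists k,
    [/\ sigE P (GRcv j i, GLst k), sigE Q (GFst k, GLst i)
      & sigV Q (GSnd i j) -> sigE Q (GFst k, GSnd i j)].
Proof.
move=> bP bQ dfP dfQ sealQP i j VP; apply: contrapT => nk.
have balP i' j' := bsl_count i' j' bP dfP.
have balQ i' j' := bsl_count i' j' bQ dfQ.
have [[u hu] nlst] := VP; have [q0 [kr [uE ckr hkr]]] := (denotes_rcvP P j i u).1 hu.
pose K := reach P u.
have KP k : K (NLst k) -> path P u (NLst k) by case=> //; rewrite uE.
have nKi : ~ K (NLst i).
  by move=> /KP h; apply: nlst; exists u, (NLst i).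
have KE k : K (NLst k) -> sigE P (GRcv j i, GLst k).
  by move=> /KP h; split=> //; exists u, (NLst k).
(* The extra send from [i] to [j], placed after [Q]. *)
pose X := Snd j (EConst (Var i) 0%R) : prog Var.
pose R := Layer P (Layer Q X).
have x0 i' j' : count (is_rcv i') (acts X j') = 0 by rewrite /=; case: ifP.
have [T [pT [krT hT hTP nT]]] : exists T pT,
    [/\ kr < T, nthp (is_snd j) (acts R i) T pT, size (acts P i) <= pT
      & ~ reached P Q u i pT].
  (* If some k satisfies (a) and (b), then (c) fails for it, so the first send from [i] to [j] in
     [Q] is in the signature. Were it reached, the process through which it is reached would satisfy
     all three conditions. *)
  case: (pselect (exists2 k, K (NLst k) & path Q (NFst k) (NLst i))) => [[k0 Kk0 h0]|nA].
    have : ~ (sigV Q (GSnd i j) -> sigE Q (GFst k0, GSnd i j)).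
      by move=> c; apply: nk; exists k0; split=> //;
        [apply: KE|split=> //; exists (NFst k0), (NLst i)].
    move=> /not_implyP [VQ _]; have [[v hv] _] := VQ.
    have [a vE ha] := hv; have as' := nth_snd_size ha.
    have [p1 hp1] := comm_pos as'; have hs := (nth_snd_acts _ _ hp1).1 ha.
    exists (count (is_snd j) (acts P i) + 0), (size (acts P i) + p1).
    split; [by rewrite balP ckr addn0|exact/nthp_catr/nthp_catl|exact: leq_addr|].
    move=> [/reached_lst //|[b [k' [Kk' h']]]].
    rewrite -addnS addKn; case: hp1 => _; rewrite /ncomm => ->; rewrite ltnS => ba.
    have {}h' := path_local_le h' ba as'; apply: nk; exists k'; split.
    - exact: KE.
    - split=> //; exists (NFst k'), (NLst i); split=> //.
      exact: t_trans h' (path_lst as').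
    - by move=> _; split=> //; exists (NFst k'), v; split=> //; rewrite vE.
  (* Otherwise the extra send is taken. Were it reached, either the last node of [i] in [P] would be
     reached, or a path of [Q] to a communication of [i] would extend to its last node; both are
     excluded. *)
  exists (count (is_snd j) (acts P i) + (count (is_snd j) (acts Q i) + 0)).
  exists (size (acts P i) + (size (acts Q i) + 0)); split.
  - by rewrite balP ckr; lia.
  - by do 2!apply: nthp_catr; rewrite /= eqxx; split=> //=; rewrite eqxx.
  - exact: leq_addr.
  move=> [/reached_lst //|[b [k' [Kk' h' bs]]]]; apply: nA; exists k' => //.
  by apply: t_trans h' (path_lst _); apply: leq_trans bs (ncomm_size _ _ _).
have [p0 hp0] := comm_pos (nth_rcv_size hkr).
have hr := (nth_rcv_acts _ _ hp0).1 hkr.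
have [rk sch] := layer_schedulable balP balQ dfP dfQ x0.
have [|||||r [rel occ dE]] := @swapped_run R i j kr T p0 pT rk (reached P Q u)
    _ sch _ krT hT _ (@reached_mono P Q u) _ _ nT.
- by case: bP bQ => slP _ [slQ _]; apply/and3P.
- by move=> i' j'; rewrite !count_cat balP balQ x0 !leq_add2l.
- exact: nthp_catl.
- exact: (reached_msg balP balQ x0).
- left; exists q0; last by left; rewrite uE.
  by case: hp0 => _; rewrite /ncomm => ->.
have [c1 [_ _ occP [c2 [_ _ occQ _]]]] := occ.
have z : sealed r (fun=> Fin 0) by move=> [k t] e' [/= t0]; lia.
have le0 (c : @cut n) : cut_le (fun=> Fin 0) c by move=> k; case: (c k).
have leo W (c c' : @cut n) : occurs W r c c' -> cut_le c c'.
  move=> o k; have := occurs_acts k o.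
  by case: (c k) => [a [-> _]|[-> _]] //=; exact: leq_addr.
have [c3 [_ _ [c4 [_ _ occP' [ec s4]]] _]] :
    occurs (Layer (Layer P Cut) Q) r (fun=> Fin 0) c2.
  apply: sealQP rel _ _ _; exists c1; split=> //; first exact: leo occQ.
  by exists (fun=> Fin 0); split.
(* The sealed cut after [P] contains the receive and must contain its send, which was chosen after
   [P]. *)
have : in_cut c4 (delta r (j, p0.+1)).
  apply: s4 (occurs_in occP' (nthp_size hr)) _; apply: receive_matched.
  by apply: (occurs_receive occP (nthp_size hr)); rewrite (nthp_rcv hr) /=.
rewrite dE => /(occurs_cases occP') [[//]|[p ps [E]]].
by move: hTP; rewrite E leqNgt ps.
Qed.

End Necessity.

Theorem theorem4 (n : nat) (Var : 'I_n -> eqType) (P Q : prog Var)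
    (bslP : BSL P) (bslQ : BSL Q)
    (dfP : deadlock_free P) (dfQ : deadlock_free Q) :
  let: (VP, EP) := Sig P in
  let: (VQ, EQ) := Sig Q in
  properly_seals Rel Q P <->
  (forall i j : 'I_n, VP (GRcv j i) ->
     exists k : 'I_n,
       [/\ EP (GRcv j i, GLst k),
           EQ (GFst k, GLst i)
         & VQ (GSnd i j) -> EQ (GFst k, GSnd i j)]).
Proof.
split=> [[sealQP _]|cond]; first exact: seal_conditions.
split; first by apply: conditions_seal cond => i j; apply: bsl_count.
move=> r _ c d d' _ [d1 [_ _ [<- _] occQ]]; exact: occurs_finite occQ.
Qed.
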